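(* Let $M^1=I$ or $M^1=\mathbb{S}^1$. The pseudometric on $\mathrm{Diff}_+^{1+AC}(M^1)$ defined by $d(f,g)=\displaystyle\int_{M^1}\left|\frac{f''}{f'}-\frac{g''}{g'}\right|$ is maximal.
   Context: $I=[0,1]$, and $\mathbb{S}^1$ is $[0,1]$ with endpoints identified (i.e. $\mathbb{R}/\mathbb{Z}$). $\mathrm{Diff}_+^{1+AC}(M^1)$ is the group (under composition) of orientation-preserving $C^1$ diffeomorphisms of $M^1$ whose first derivative is absolutely continuous (so the second derivative exists almost everywhere), a Polish group with topology given by the metric $\rho(f,g)=\sup_{x\in M^1}|f(x)-g(x)|+\sup_{x\in M^1}|f'(x)-g'(x)|+\int_{M^1}|f''-g''|$ (for $M^1=\mathbb{S}^1$, $|f(x)-g(x)|$ denotes distance in $\mathbb{S}^1$). A pseudometric $d$ on a topological group $G$ is maximal if it is continuous, right-invariant, and for every continuous right-invariant pseudometric $\sigma$ on $G$ there are constants $K,C$ with $\sigma\le K\cdot d+C$. *)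

(* Defs.v *)
From HB Require Import structures.
From mathcomp Require Import all_boot all_order all_algebra.
From mathcomp Require Import all_classical all_reals all_analysis.
From mathcomp Require Import generic_quotient.
From mathcomp Require Import ring lra.

Set Implicit Arguments.
Unset Strict Implicit.
Unset Printing Implicit Defensive.

Import Order.TTheory GRing.Theory Num.Theory.
Import numFieldNormedType.Exports.

Local Open Scope classical_set_scope.
Local Open Scope ring_scope.

(* As with PreTopologicalNmodule, compatibility of the group operations with the
   topology is not part of the structure. *)
HB.structure Definition PreTopologicalGroup := {G of Topological G & Group G}.

Section MaximalPseudometric.
Context {R : realType}.

Definition is_pseudometric (T : Type) (d : T -> T -> R) : Prop :=
  [/\ forall x y, 0 <= d x y,
      forall x, d x x = 0,
      forall x y, d x y = d y x
    & forall x y z, d x z <= d x y + d y z].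

Definition right_invariant (G : groupType) (d : G -> G -> R) : Prop :=
  forall f g h : G, d (f * h)%g (g * h)%g = d f g.

Definition continuous_right_invariant_pseudometric
    (G : PreTopologicalGroup.type) (d : G -> G -> R) : Prop :=
  [/\ is_pseudometric d,
      continuous (fun p : G * G => d p.1 p.2)
    & right_invariant d].

Definition maximal_pseudometric
    (G : PreTopologicalGroup.type) (d : G -> G -> R) : Prop :=
  continuous_right_invariant_pseudometric d /\
  forall s : G -> G -> R, continuous_right_invariant_pseudometric s ->
    exists K C : R, forall f g : G, s f g <= K * d f g + C.

End MaximalPseudometric.

Section MetricOpen.
Context {R : realType} (T : Type) (rho : T -> T -> R).

Definition metric_open : set (set T) :=
  [set U | forall f, U f ->
     exists2 e, 0 < e & forall g, rho f g < e -> U g].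

Lemma metric_openT : metric_open setT.
Proof. by move=> f _; exists 1. Qed.

Lemma metric_openI : setI_closed metric_open.
Proof.
move=> U V oU oV f [/oU[e e0 eU] /oV[e' e'0 eV]].
exists (Num.min e e'); first by rewrite lt_min e0.
by move=> g; rewrite lt_min => /andP[/eU ? /eV].
Qed.

Lemma metric_open_bigU (I : Type) (U : I -> set T) :
  (forall i, metric_open (U i)) -> metric_open (\bigcup_i U i).
Proof.
move=> oU f [i _ /oU[e e0 eU]]; exists e => // g /eU Ug.
by exists i.
Qed.

End MetricOpen.

Section AbsolutelyContinuous.
Context {R : realType}.
Implicit Types (a b : R) (u v h : R -> R).

Definition abs_continuous a b u : Prop :=
  forall e, 0 < e -> exists2 d, 0 < d &
    forall (n : nat) (s t : 'I_n -> R),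
      (forall i, [/\ a <= s i, s i <= t i & t i <= b]) ->
      (forall i j, i != j -> t i <= s j \/ t j <= s i) ->
      \sum_i (t i - s i) < d ->
      \sum_i `|u (t i) - u (s i)| < e.

Lemma abs_continuous_dom a b u v (w : R -> R) (K L : R) :
  abs_continuous a b u -> abs_continuous a b v ->
  (forall x y, a <= x -> x <= y -> y <= b ->
     `|w y - w x| <= K * `|u y - u x| + L * `|v y - v x|) ->
  abs_continuous a b w.
Proof.
move=> acu acv wuv e e0.
have p0 : 0 < `|K| + `|L| + 1 by rewrite ltr_wpDl// addr_ge0.
have [d1 d10 d1u] := acu (e / (`|K| + `|L| + 1)) (divr_gt0 e0 p0).
have [d2 d20 d2v] := acv (e / (`|K| + `|L| + 1)) (divr_gt0 e0 p0).
exists (Num.min d1 d2); first by rewrite lt_min d10.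
move=> n s t st dj; rewrite lt_min => /andP[/(d1u _ _ _ st dj) + /(d2v _ _ _ st dj)].
set U := \sum_i _; set V := \sum_i _ => Ue Ve.
have U0 : 0 <= U by apply: sumr_ge0.
have V0 : 0 <= V by apply: sumr_ge0.
apply: (@le_lt_trans _ _ (`|K| * U + `|L| * V)).
  rewrite !mulr_sumr -big_split/=; apply: ler_sum => i _.
  have [as_ st_ tb] := st i.
  apply: (le_trans (wuv _ _ as_ st_ tb)).
  by apply: lerD; apply: ler_wpM2r => //; exact: ler_norm.
move: Ue Ve; rewrite !ltr_pdivlMr// => Ue Ve.
have : (`|K| * U + `|L| * V) <= Num.max U V * (`|K| + `|L|).
  rewrite mulrDr; apply: lerD; rewrite mulrC ler_wpM2r//.
    by rewrite le_max lexx.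
  by rewrite le_max lexx orbT.
move=> /le_lt_trans; apply.
have [UV|VU] := leP U V.
  by apply: le_lt_trans Ve; rewrite ler_wpM2l// lerDl.
by apply: le_lt_trans Ue; rewrite ler_wpM2l// lerDl.
Qed.

Lemma abs_continuous_comp a b a' b' u h (L : R) :
  abs_continuous a' b' u ->
  (forall x, a <= x <= b -> a' <= h x <= b') ->
  (forall x y, a <= x -> x <= y -> y <= b -> h x <= h y <= h x + L * (y - x)) ->
  abs_continuous a b (u \o h).
Proof.
move=> acu hab hL e e0.
have p0 : 0 < `|L| + 1 by rewrite ltr_wpDl.
have [d d0 du] := acu e e0.
exists (d / (`|L| + 1)); first exact: divr_gt0.
move=> n s t st dj; rewrite ltr_pdivlMr// => std /=.
have hst i : h (s i) <= h (t i) <= h (s i) + L * (t i - s i).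
  by have [? ? ?] := st i; exact: hL.
have sab i : a <= s i <= b by have [? ? ?] := st i; apply/andP; split; lra.
have tab i : a <= t i <= b by have [? ? ?] := st i; apply/andP; split; lra.
apply: du.
- move=> i; split; first by have /andP[] := hab _ (sab i).
    by have /andP[] := hst i.
  by have /andP[] := hab _ (tab i).
- move=> i j /dj[tisj|tjsi]; [left|right].
    by have /andP[] := hL (t i) (s j) (andP (tab i)).1 tisj (andP (sab j)).2.
  by have /andP[] := hL (t j) (s i) (andP (tab j)).1 tjsi (andP (sab i)).2.
- apply: le_lt_trans std; rewrite mulr_suml; apply: ler_sum => i _.
  have /andP[_ hi] := hst i; have [_ si _] := st i.
  have := ler_norm L.
  have : 0 <= t i - s i by rewrite subr_ge0.
  nra.
Qed.

Lemma eq_abs_continuous a b u v :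
  (forall x, a <= x <= b -> u x = v x) ->
  abs_continuous a b u -> abs_continuous a b v.
Proof.
move=> uv acu e /acu[d d0 du]; exists d => // n s t st dj /(du _ _ _ st dj).
rewrite (eq_bigr (fun i => `|v (t i) - v (s i)|))// => i _.
have [? ? ?] := st i; rewrite !uv//; apply/andP; split; lra.
Qed.

Lemma abs_continuousM a b u v (M : R) :
  (forall x, a <= x <= b -> `|u x| <= M) ->
  (forall x, a <= x <= b -> `|v x| <= M) ->
  abs_continuous a b u -> abs_continuous a b v ->
  abs_continuous a b (fun x => u x * v x).
Proof.
move=> uM vM acu acv; apply: (abs_continuous_dom acu acv (K := M) (L := M)).
move=> x y ax xy yb.
have -> : u y * v y - u x * v x = (u y - u x) * v y + u x * (v y - v x) by ring.
rewrite (le_trans (ler_normD _ _))// !normrM; apply: lerD.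
  by rewrite mulrC ler_wpM2r// vM//; apply/andP; split; lra.
by rewrite ler_wpM2r// uM//; apply/andP; split; lra.
Qed.

Lemma abs_continuousV a b u v (M : R) :
  (forall x, a <= x <= b -> u x * v x = 1) ->
  (forall x, a <= x <= b -> `|v x| <= M) ->
  abs_continuous a b u -> abs_continuous a b v.
Proof.
move=> uv vM acu.
apply: (abs_continuous_dom acu acu (K := M * M) (L := 0)) => x y ax xy yb.
have xab : a <= x <= b by apply/andP; split; lra.
have yab : a <= y <= b by apply/andP; split; lra.
have -> : v y - v x = v x * v y * (u x - u y).
  have -> : v x * v y * (u x - u y) = (u x * v x) * v y - (u y * v y) * v x by ring.
  by rewrite !uv// !mul1r.
rewrite mul0r addr0 !normrM (distrC (u x)) ler_wpM2r// ler_pM//; exact: vM.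
Qed.

Lemma abs_continuous_cst a b (c : R) : abs_continuous a b (fun=> c).
Proof.
move=> e e0; exists 1 => // n s t _ _ _.
by rewrite big1// => i _; rewrite subrr normr0.
Qed.

End AbsolutelyContinuous.
Section Interval.
Context {R : realType}.
Implicit Types (f g h : R -> R) (x y : R).
Local Notation I := (`[0%R, 1%R]%classic : set R).

Definition slope_fun f x y : R := (f y - f x) / (y - x).

(* Derivative relative to [0, 1]: one-sided at 0 and 1. Where the limit does not
   exist the value is arbitrary; for derive_I (derive_I f), with f as in
   is_diff_I below, this only happens on a null set. *)
Definition derive_I f x : R := lim (slope_fun f x @ within I x^').

Definition C1_I f : Prop :=
  (forall x, I x -> cvg (slope_fun f x @ within I x^')) /\
  {within I, continuous (derive_I f)}.

(* A diffeomorphism of [0, 1] is represented by its extension to R by the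
   identity, so that equality and composition of functions R -> R are those of
   maps [0, 1] -> [0, 1]. The bijectivity of f on R together with the first
   clause makes f restrict to a bijection of [0, 1]. *)
Definition is_diff_I f : Prop :=
  [/\ forall x, ~ I x -> f x = x,
      {in I &, {homo f : x y / x < y}},
      C1_I f,
      exists g, [/\ cancel f g, cancel g f & C1_I g]
    & abs_continuous 0 1 (derive_I f)].

Local Lemma within_I_proper x : I x -> ProperFilter (within I x^').
Proof.
move=> /= /[!in_itv]/= /andP[x0 x1].
apply: Build_ProperFilter_ex => P [/= e /= e0 eP].
pose y := if x <= 2^-1 then x + Num.min (e / 2) (2^-1) else x - Num.min (e / 2) (2^-1).
have m0 : 0 < Num.min (e / 2) 2^-1 :> R by rewrite lt_min divr_gt0//= invr_gt0.
have m1 : Num.min (e / 2) 2^-1 <= 2^-1 :> R by rewrite ge_min lexx orbT.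
have me : Num.min (e / 2) 2^-1 <= e / 2 by rewrite ge_min lexx.
have xyE : `|x - y| = Num.min (e / 2) 2^-1.
  rewrite /y; case: ifP => _.
    by rewrite opprD addrA subrr sub0r normrN gtr0_norm.
  by rewrite opprB addrC subrK gtr0_norm.
exists y; apply: eP => /=.
- by rewrite xyE; lra.
- by apply/eqP => yx; move: xyE; rewrite yx subrr normr0; lra.
- rewrite in_itv/= /y; case: ifPn => [?|/negP]; first by apply/andP; split; lra.
  by move=> /negP; rewrite -ltNge => ?; apply/andP; split; lra.
Qed.

Lemma derive_IE f x (l : R) : I x -> slope_fun f x @ within I x^' --> l -> derive_I f x = l.
Proof. by move=> Ix fl; have PF := within_I_proper Ix; exact: cvg_lim fl. Qed.

Lemma C1_I_cvg f x : C1_I f -> I x -> slope_fun f x @ within I x^' --> derive_I f x.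
Proof. by move=> [+ _] Ix => /(_ _ Ix). Qed.

Lemma slope_fun_cvg_continuous f x (l : R) :
  slope_fun f x @ within I x^' --> l -> f @ within I x^' --> f x.
Proof.
move=> fl.
have : (fun y => f x + slope_fun f x y * (y - x)) @ within I x^' --> f x + l * (x - x).
  apply: cvgD; first exact: cvg_cst.
  apply: cvgM => //; apply: cvgB; last exact: cvg_cst.
  by apply: cvg_trans (@cvg_id _ (nbhs x)) => A; apply: filterS => y Ay _ _.
rewrite subrr mulr0 addr0; apply: cvg_trans; apply: near_eq_cvg.
near=> y.
have yx : y - x != 0 by rewrite subr_eq0; near: y; apply: filterS (nbhs_dnbhs_neq x) => // z + _.
by rewrite /slope_fun divfK// addrC subrK.
Unshelve. all: by end_near. Qed.

Lemma C1_I_continuous f : C1_I f -> {within I, continuous f}.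
Proof.
move=> Cf; apply/subspace_continuousP => x Ix A Afx.
have H := slope_fun_cvg_continuous (C1_I_cvg Cf Ix).
have {H} : \forall y \near x, y != x -> I y -> A (f y) by apply: (H A Afx).
apply: filterS => y yA Iy.
by have [->|yx] := eqVneq y x; [exact: nbhs_singleton Afx | exact: yA].
Qed.

Lemma C1_I_is_derive f x : C1_I f -> 0 < x < 1 -> is_derive x 1 f (derive_I f x).
Proof.
move=> Cf /andP[x0 x1].
have Ix : I x by rewrite /= in_itv/=; apply/andP; split; lra.
have fx := C1_I_cvg Cf Ix.
have sh : (fun h : R => h + x) @ 0^' --> within I x^'.
  have e0 : 0 < Num.min x (1 - x) by rewrite lt_min x0 subr_gt0.
  move=> A; rewrite /within/= => -[e /= e1 eA].
  exists (Num.min e (Num.min x (1 - x))) => /=; first by rewrite lt_min e1.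
  move=> h/=; rewrite sub0r normrN lt_min => /andP[he] + h0.
  rewrite lt_min ltr_norml (ltr_norml _ (1 - x)) => /andP[/andP[h1 _] /andP[_ h2]].
  apply: eA => /=.
  - by rewrite opprD addrC subrK normrN.
  - by rewrite -subr_eq0 addrK.
  - by rewrite in_itv/=; apply/andP; split; lra.
have H : (fun r : R => r^-1 *: ((f \o shift x) (r *: 1) - f x)) @ 0^' --> derive_I f x.
  have := cvg_comp _ _ sh fx; apply: cvg_trans; apply: near_eq_cvg.
  near=> r; rewrite /= /slope_fun /shift/= addrK scaler1 mulrC /GRing.scale/=.
  by [].
by apply: DeriveDef; [apply/cvg_ex; exists (derive_I f x) | exact: cvg_lim H].
Unshelve. all: by end_near. Qed.

Lemma C1_I_bounded f : C1_I f -> exists M, forall x, I x -> `|derive_I f x| <= M.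
Proof.
move=> [_ cf].
have [c1 _ m1] := EVT_max (@ler01 R) cf.
have [c2 _ m2] := EVT_min (@ler01 R) cf.
exists (Num.max `|derive_I f c1| `|derive_I f c2|) => x Ix.
have xI : x \in (`[0%R, 1%R] : interval R) by [].
rewrite le_max ler_norml; have := m1 _ xI; have := m2 _ xI.
have := ler_norm (derive_I f c1); have := ler_norm (- derive_I f c2); rewrite normrN.
have [d0|d0] := leP 0 (derive_I f x).
  by move=> *; apply/orP; left; apply/andP; split; lra.
move=> *; apply/orP; right; rewrite ler_norml; apply/andP; split; lra.
Qed.

Lemma C1_I_lipschitz f : C1_I f ->
  exists L, forall x y, 0 <= x -> x <= y -> y <= 1 -> `|f y - f x| <= L * (y - x).
Proof.
move=> Cf; have [M fM] := C1_I_bounded Cf.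
exists M => x y x0 xy y1.
have sub : `[x, y] `<=` I.
  by move=> z/=; rewrite !in_itv/= => /andP[? ?]; apply/andP; split; lra.
have cf := continuous_subspaceW sub (C1_I_continuous Cf).
have [|c cxy ->] := @MVT_segment R f (derive_I f) x y xy _ cf.
  move=> z; rewrite in_itv/= => /andP[? ?]; apply: C1_I_is_derive => //.
  by apply/andP; split; lra.
rewrite normrM (@ger0_norm _ (y - x)) ?subr_ge0// ler_wpM2r ?subr_ge0//.
by apply: fM; apply: sub.
Qed.

Lemma slope_fun_comp f h x (l m : R) :
  {in I &, injective h} -> (forall y, I y -> I (h y)) -> I x ->
  slope_fun f (h x) @ within I (h x)^' --> l ->
  slope_fun h x @ within I x^' --> m ->
  slope_fun (f \o h) x @ within I x^' --> l * m.
Proof.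
move=> ih hI Ix fl hm.
have hc := slope_fun_cvg_continuous hm.
have hw : h @ within I x^' --> within I (h x)^'.
  move=> A hA.
  have {hA} hA : \forall z \near h x, z != h x -> I z -> A z by exact: hA.
  have {hA} : \forall y \near x, y != x -> I y -> (h y != h x -> I (h y) -> A (h y)).
    by apply: (hc _ hA).
  apply: filterS => y hA yx Iy.
  apply: (hA yx Iy); last exact: hI.
  by apply: contra_neq yx => hyx; apply: ih; rewrite ?inE.
have Hlm : (fun y => slope_fun f (h x) (h y) * slope_fun h x y) @ within I x^' --> l * m.
  by apply: cvgM => //; exact: (cvg_comp _ _ hw fl).
apply: cvg_trans Hlm; apply: (@near_eq_cvg _ _ (within I x^') _ (fun y => slope_fun f (h x) (h y) * slope_fun h x y)).
suff H : \forall y \near x, y != x -> I y ->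
    (slope_fun f (h x) (h y) * slope_fun h x y) = slope_fun (f \o h) x y by exact: H.
near=> y => yx Iy.
have hyx : h y - h x != 0.
  by rewrite subr_eq0; apply: contra_neq yx => hyx; apply: ih; rewrite ?inE.
rewrite /slope_fun /=;
 field; rewrite hyx/= subr_eq0 yx.
Unshelve. all: by end_near. Qed.

Lemma derive_I_comp f h x :
  {in I &, injective h} -> (forall y, I y -> I (h y)) ->
  C1_I f -> C1_I h -> I x -> derive_I (f \o h) x = derive_I f (h x) * derive_I h x.
Proof.
move=> ih hI Cf Ch Ix; apply: derive_IE => //; apply: slope_fun_comp => //.
  by apply: C1_I_cvg => //; exact: hI.
exact: C1_I_cvg.
Qed.

Lemma C1_I_comp f h :
  {in I &, injective h} -> (forall y, I y -> I (h y)) ->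
  C1_I f -> C1_I h -> C1_I (f \o h).
Proof.
move=> ih hI Cf Ch; split=> [x Ix|].
  apply/cvg_ex; exists (derive_I f (h x) * derive_I h x); apply: slope_fun_comp => //.
    by apply: C1_I_cvg => //; exact: hI.
  exact: C1_I_cvg.
have [_ /subspace_continuousP cf] := Cf.
have [_ /subspace_continuousP ch] := Ch.
have /subspace_continuousP hc := C1_I_continuous Ch.
apply/subspace_continuousP => x Ix.
have hw : h @ within I (nbhs x) --> within I (nbhs (h x)).
  move=> A hA.
  have {hA} hA : \forall z \near h x, I z -> A z by exact: hA.
  have {hA} : \forall y \near x, I y -> (I (h y) -> A (h y)).
    by apply: (hc _ Ix _ hA).
  by apply: filterS => y hA Iy; apply: (hA Iy); exact: hI.
rewrite /from_subspace (derive_I_comp ih hI Cf Ch Ix).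
have H : (fun y => derive_I f (h y) * derive_I h y) @ within I (nbhs x) --> derive_I f (h x) * derive_I h x.
  apply: cvgM; last exact: ch.
  by apply: (cvg_comp _ _ hw); apply: cf; exact: hI.
apply: cvg_trans H; apply: (@near_eq_cvg _ _ (within I (nbhs x))).
suff : \forall y \near x, I y -> derive_I f (h y) * derive_I h y = derive_I (f \o h) y by [].
by near=> y => Iy; rewrite derive_I_comp.
Unshelve. all: by end_near. Qed.

Lemma derive_I_id x : I x -> derive_I id x = 1.
Proof.
move=> Ix; apply: derive_IE => //.
apply: (@cvg_trans _ ((fun=> 1 : R) @ within I x^')); last exact: cvg_cst.
apply: (@near_eq_cvg _ _ (within I x^')).
suff : \forall y \near x, y != x -> I y -> 1 = slope_fun id x y by [].
by near=> y => yx Iy; rewrite /slope_fun divff// subr_eq0.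
Unshelve. all: by end_near. Qed.

Lemma C1_I_id : C1_I id.
Proof.
split=> [x Ix|].
  apply/cvg_ex; exists 1.
  apply: (@cvg_trans _ ((fun=> 1 : R) @ within I x^')); last exact: cvg_cst.
  apply: (@near_eq_cvg _ _ (within I x^')).
  suff : \forall y \near x, y != x -> I y -> 1 = slope_fun id x y by [].
  by near=> y => yx Iy; rewrite /slope_fun divff// subr_eq0.
apply: (@subspace_eq_continuous _ I _ (fun=> 1 : R)).
  by move=> x /[!inE] Ix; rewrite /from_subspace derive_I_id.
by apply: continuous_subspaceT => x; exact: cvg_cst.
Unshelve. all: by end_near. Qed.

Lemma is_diff_I_id : is_diff_I id.
Proof.
split=> //; first exact: C1_I_id.
  by exists id; split=> //; exact: C1_I_id.
apply: eq_abs_continuous (@abs_continuous_cst _ 0 1 1) => x x01.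
by rewrite derive_I_id//= in_itv.
Qed.

Lemma is_diff_I_inj f : is_diff_I f -> injective f.
Proof. by case=> _ _ _ [g [fK _ _]] _; exact: can_inj fK. Qed.

Lemma is_diff_I_stable f x : is_diff_I f -> I x -> I (f x).
Proof.
move=> df Ix; apply: contrapT => nI; have [off _ _ _ _] := df.
by have := off _ nI => /(is_diff_I_inj df) fxx; apply: nI; rewrite fxx.
Qed.

Lemma is_diff_I_le f x y : is_diff_I f -> I x -> I y -> x <= y -> f x <= f y.
Proof.
move=> [_ inc _ _ _] Ix Iy; rewrite le_eqVlt => /predU1P[->//|xy].
by apply/ltW/inc; rewrite ?inE.
Qed.

Lemma abs_continuous_comp_diff u f :
  (forall x, I x -> I (f x)) ->
  (forall x y, I x -> I y -> x <= y -> f x <= f y) -> C1_I f ->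
  abs_continuous 0 1 u -> abs_continuous 0 1 (u \o f).
Proof.
move=> fI fle Cf acu; have [L fL] := C1_I_lipschitz Cf.
apply: (abs_continuous_comp (L := L) acu) => [x x01|x y x0 xy y1].
  by have := fI x; rewrite /= !in_itv/=; apply.
have xy' : f x <= f y.
  by apply: fle => //=; rewrite in_itv/=; apply/andP; split; lra.
rewrite xy'/= -lerBlDl; apply: le_trans (fL _ _ x0 xy y1).
exact: ler_norm.
Qed.

Lemma abs_continuous_derive_I_comp f h : is_diff_I f -> is_diff_I h ->
  abs_continuous 0 1 (derive_I (f \o h)).
Proof.
move=> df dh.
have [_ _ Cf _ acf] := df; have [_ _ Ch _ ach] := dh.
have hI x : I x -> I (h x) by exact: is_diff_I_stable.
have ih : {in I &, injective h} by move=> x y _ _; exact: is_diff_I_inj.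
have [M fM] := C1_I_bounded Cf; have [N hN] := C1_I_bounded Ch.
apply: (@eq_abs_continuous _ _ _ (fun x => derive_I f (h x) * derive_I h x)) => [x x01|].
  by rewrite derive_I_comp//= in_itv.
apply: (abs_continuousM (M := Num.max M N)) => // [x x01|x x01|].
- by rewrite le_max fM//; apply: hI; rewrite /= in_itv.
- by rewrite le_max hN ?orbT//= in_itv.
- apply: abs_continuous_comp_diff => // x y; exact: is_diff_I_le.
Qed.

Lemma is_diff_I_comp f h : is_diff_I f -> is_diff_I h -> is_diff_I (f \o h).
Proof.
move=> df dh.
have hI x : I x -> I (h x) by exact: is_diff_I_stable.
have fI x : I x -> I (f x) by exact: is_diff_I_stable.
have inj k : injective k -> {in I &, injective k} by move=> ik x y _ _; exact: ik.
have [foff finc Cf [f' [fK f'K Cf']] acf] := df.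
have [hoff hinc Ch [h' [hK h'K Ch']] ach] := dh.
split.
- by move=> x nx /=; rewrite hoff// foff.
- move=> x y Ix Iy xy /=; apply: finc; last exact: hinc.
    by move: Ix; rewrite !inE; exact: hI.
  by move: Iy; rewrite !inE; exact: hI.
- apply: C1_I_comp => //; apply: inj; exact: can_inj hK.
- exists (h' \o f'); split; [exact: can_comp | exact: can_comp |].
  apply: C1_I_comp => //; first by apply: inj; exact: can_inj f'K.
  move=> y Iy; apply: contrapT => nI; apply: (nI).
  by rewrite -[f' y]foff// f'K.
- exact: abs_continuous_derive_I_comp.
Qed.

Lemma is_diff_I_inv f g : is_diff_I f -> cancel f g -> cancel g f -> is_diff_I g.
Proof.
move=> df fK gK; have [foff finc Cf [g' [fK' g'K Cg]] acf] := df.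
have gg' : g' = g by apply/funext => x; rewrite -[x in LHS]gK fK'.
rewrite {g'}gg' in fK' g'K Cg.
have goff x : ~ I x -> g x = x by move=> nx; rewrite -[in LHS](foff x nx) fK.
have gI x : I x -> I (g x).
  by move=> Ix; apply: contrapT => nI; apply: (nI); rewrite -[g x]foff// gK.
have ginc : {in I &, {homo g : x y / x < y}}.
  move=> x y; rewrite !inE => Ix Iy xy; rewrite ltNge; apply/negP => gyx.
  have := is_diff_I_le df (gI _ Iy) (gI _ Ix) gyx.
  by rewrite !gK leNgt xy.
have ig : {in I &, injective g} by move=> x y _ _; exact: can_inj gK _ _.
split=> //; first by exists f.
have [N gN] := C1_I_bounded Cg.
apply: (abs_continuousV (u := derive_I f \o g) (M := N)) => [x x01|x x01|].
- have Ix : I x by rewrite /= in_itv.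
  rewrite /= -derive_I_comp// -(derive_I_id Ix); congr (derive_I _ _).
  by apply/funext => y /=; exact: gK.
- by apply: gN; rewrite /= in_itv.
- apply: abs_continuous_comp_diff => // x y Ix Iy.
  by rewrite le_eqVlt => /predU1P[->//|xy]; apply/ltW/ginc; rewrite ?inE.
Qed.
End Interval.

Section DiffInterval.
Context {R : realType}.
Local Notation I := (`[0%R, 1%R]%classic : set R).

Record diff_I : Type := DiffI {
  diff_I_fun :> R -> R ;
  diff_I_prop : is_diff_I diff_I_fun }.

Lemma diff_I_ext (f g : diff_I) : f =1 g -> f = g.
Proof.
case: f g => [f fP] [g gP] /= /funext fg; case: _ / fg in gP *.
by congr DiffI; exact: Prop_irrelevance.
Qed.

HB.instance Definition _ := gen_eqMixin diff_I.
HB.instance Definition _ := gen_choiceMixin diff_I.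

Lemma diff_I_inverse (f : diff_I) :
  exists g : diff_I, cancel f g /\ cancel g f.
Proof.
have [_ _ _ [g [fK gK _]] _] := diff_I_prop f.
by exists (DiffI (is_diff_I_inv (diff_I_prop f) fK gK)).
Qed.

Definition diff_I_one : diff_I := DiffI (@is_diff_I_id R).
Definition diff_I_mul (f g : diff_I) : diff_I :=
  DiffI (is_diff_I_comp (diff_I_prop f) (diff_I_prop g)).
Definition diff_I_inv (f : diff_I) : diff_I := sval (cid (diff_I_inverse f)).

Lemma diff_I_mulA : associative diff_I_mul.
Proof. by move=> f g h; exact: diff_I_ext. Qed.

Lemma diff_I_mul1 : left_id diff_I_one diff_I_mul.
Proof. by move=> f; exact: diff_I_ext. Qed.

Lemma diff_I_mulr1 : right_id diff_I_one diff_I_mul.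
Proof. by move=> f; exact: diff_I_ext. Qed.

Lemma diff_I_mulV : left_inverse diff_I_one diff_I_inv diff_I_mul.
Proof.
move=> f; apply: diff_I_ext => x /=; rewrite /diff_I_inv.
by case: cid => g [].
Qed.

Lemma diff_I_mulrV : right_inverse diff_I_one diff_I_inv diff_I_mul.
Proof.
move=> f; apply: diff_I_ext => x /=; rewrite /diff_I_inv.
by case: cid => g [].
Qed.

HB.instance Definition _ := isGroup.Build diff_I
  diff_I_mulA diff_I_mul1 diff_I_mulr1 diff_I_mulV diff_I_mulrV.

Definition rho_I (f g : diff_I) : R :=
  sup [set `|f x - g x| | x in I] +
  sup [set `|derive_I f x - derive_I g x| | x in I] +
  \int[lebesgue_measure]_(x in I) `|derive_I (derive_I f) x - derive_I (derive_I g) x|.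

HB.instance Definition _ := isOpenTopological.Build diff_I
  (metric_openT rho_I) (@metric_openI _ _ rho_I) (@metric_open_bigU _ _ rho_I).

Definition nonlinearity_dist_I (f g : diff_I) : R :=
  \int[lebesgue_measure]_(x in I)
    `|derive_I (derive_I f) x / derive_I f x - derive_I (derive_I g) x / derive_I g x|.

End DiffInterval.
Arguments diff_I : clear implicits.

Section Circle.
Context {R : realType}.
Implicit Types (x y : R) (F G H : R -> R).

Definition eqmodZ : rel R := fun x y => x - y \is a Num.int.

Lemma eqmodZ_refl : reflexive eqmodZ.
Proof. by move=> x; rewrite /eqmodZ subrr rpred0. Qed.

Lemma eqmodZ_sym : symmetric eqmodZ.
Proof. by move=> x y; rewrite /eqmodZ -opprB rpredN. Qed.

Lemma eqmodZ_trans : transitive eqmodZ.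
Proof. by move=> y x z xy yz; rewrite /eqmodZ -(subrKA y) rpredD. Qed.

Canonical eqmodZ_equiv := EquivRel eqmodZ eqmodZ_refl eqmodZ_sym eqmodZ_trans.

Definition circle : Type := {eq_quot eqmodZ_equiv}%qT.
Definition circle_proj (x : R) : circle := (\pi_({eq_quot eqmodZ_equiv}) x)%qT.

Lemma circle_projP x y :
  circle_proj x = circle_proj y <-> x - y \is a Num.int.
Proof. by split=> [/eqmodP//|xy]; apply/eqmodP. Qed.

Lemma circle_proj_surj (p : circle) : exists x, circle_proj x = p.
Proof. by exists (repr p); rewrite /circle_proj reprK. Qed.

Definition circle_dist (p q : circle) : R :=
  inf [set `|x - y| | x in circle_proj @^-1` [set p]
                    & y in circle_proj @^-1` [set q]].

(* C^1 maps of the circle R / Z are those having a C^1 lift R -> R; the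
   derivative of the map is the (1-periodic) derivative of the lift, and it is
   absolutely continuous on the circle iff it is so on every [a, b]. *)
Definition is_lift (f : circle -> circle) F : Prop :=
  forall x, f (circle_proj x) = circle_proj (F x).

Definition C1 F : Prop := (forall x, derivable F x 1) /\ continuous F^`()%classic.

Definition is_diff_circle (f : circle -> circle) : Prop :=
  (exists F, [/\ is_lift f F,
                 {homo F : x y / x < y},
                 C1 F
               & forall a b, abs_continuous a b F^`()%classic]) /\
  (exists g, [/\ cancel f g, cancel g f & exists2 G, is_lift g G & C1 G]).

Lemma C1_continuous F : C1 F -> continuous F.
Proof. by move=> [dF _] x; apply/differentiable_continuous/derivable1_diffP. Qed.

Lemma C1_bounded F a b : C1 F -> exists M, forall x, a <= x <= b -> `|F^`()%classic x| <= M.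
Proof.
move=> [_ cF]; have [ab|ba] := leP a b; last first.
  by exists 0 => x /andP[ax xb]; exfalso; lra.
have cf : {within `[a, b], continuous F^`()%classic} by exact: continuous_subspaceT.
have [c1 _ m1] := EVT_max ab cf.
have [c2 _ m2] := EVT_min ab cf.
exists (Num.max `|F^`()%classic c1| `|F^`()%classic c2|) => x xab.
have xI : x \in (`[a, b] : interval R) by rewrite in_itv.
rewrite le_max ler_norml; have := m1 _ xI; have := m2 _ xI.
have := ler_norm (F^`()%classic c1); have := ler_norm (- F^`()%classic c2); rewrite normrN.
have [d0|d0] := leP 0 (F^`()%classic x).
  by move=> *; apply/orP; left; apply/andP; split; lra.
move=> *; apply/orP; right; rewrite ler_norml; apply/andP; split; lra.
Qed.

Lemma C1_lipschitz F a b : C1 F ->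
  exists L, forall x y, a <= x -> x <= y -> y <= b -> `|F y - F x| <= L * (y - x).
Proof.
move=> CF; have [M FM] := C1_bounded a b CF.
exists M => x y ax xy yb.
have cf : {within `[x, y], continuous F}.
  by apply: continuous_subspaceT; exact: C1_continuous.
have [|c] := @MVT_segment R F F^`()%classic x y xy _ cf.
  by move=> z _; rewrite derive1E; apply: DeriveDef => //; exact: CF.1.
rewrite in_itv/= => /andP[xc cy] ->.
rewrite normrM (@ger0_norm _ (y - x)) ?subr_ge0// ler_wpM2r ?subr_ge0//.
by apply: FM; apply/andP; split; lra.
Qed.

Lemma C1_comp F H : C1 F -> C1 H -> C1 (F \o H).
Proof.
move=> CF CH; have cH := C1_continuous CH; case: CF CH => [dF cF] [dH cH'].
split=> [x|].
  by apply/derivable1_diffP/differentiable_comp; apply/derivable1_diffP.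
have -> : (F \o H)^`()%classic = fun x => F^`()%classic (H x) * H^`()%classic x.
  by apply/funext => x; rewrite derive1_comp.
by move=> x; apply: cvgM; [apply: continuous_comp; [exact: cH|exact: cF]|exact: cH'].
Qed.

Lemma homo_lt_le F x y : {homo F : x y / x < y} -> x <= y -> F x <= F y.
Proof.
move=> inc; rewrite le_eqVlt => /predU1P[->//|xy].
exact/ltW/inc.
Qed.

Lemma abs_continuous_comp_C1 u H a b :
  {homo H : x y / x < y} -> C1 H ->
  (forall a b, abs_continuous a b u) -> abs_continuous a b (u \o H).
Proof.
move=> inc CH acu; have [L HL] := C1_lipschitz a b CH.
apply: (abs_continuous_comp (L := L) (acu (H a) (H b))) => [x /andP[ax xb]|x y x0 xy y1].
  by rewrite !homo_lt_le.
rewrite homo_lt_le//= -lerBlDl; apply: le_trans (HL _ _ x0 xy y1).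
exact: ler_norm.
Qed.

Lemma is_lift_comp f h F H : is_lift f F -> is_lift h H -> is_lift (f \o h) (F \o H).
Proof. by move=> fF hH x /=; rewrite hH fF. Qed.

Lemma C1_id : C1 id.
Proof.
split; first by move=> x; exact: derivable_id.
have -> : (id : R -> R)^`()%classic = fun=> 1 by apply/funext => x; rewrite derive1_id.
by move=> x; exact: cvg_cst.
Qed.

Lemma is_diff_circle_id : is_diff_circle id.
Proof.
split; first exists id.
  split=> //; first exact: C1_id.
  have -> : (id : R -> R)^`()%classic = fun=> 1 by apply/funext => x; rewrite derive1_id.
  by move=> a b; exact: abs_continuous_cst.
by exists id; split=> //; exists id => //; exact: C1_id.
Qed.

Lemma is_diff_circle_comp f h :
  is_diff_circle f -> is_diff_circle h -> is_diff_circle (f \o h).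
Proof.
move=> [[F [fF incF CF acF]] [f' [fK f'K [F' fF' CF']]]].
move=> [[H [hH incH CH acH]] [h' [hK h'K [H' hH' CH']]]]; split.
  exists (F \o H); split.
  - exact: is_lift_comp.
  - by move=> x y xy; apply/incF/incH.
  - exact: C1_comp.
  - move=> a b.
    have [M FM] := C1_bounded (H a) (H b) CF; have [N HN] := C1_bounded a b CH.
    have -> : (F \o H)^`()%classic = fun x => F^`()%classic (H x) * H^`()%classic x.
      by apply/funext => x; rewrite derive1_comp//; [exact: CH.1|exact: CF.1].
    apply: (abs_continuousM (M := Num.max M N)) => // [x /andP[ax xb]|x xab|].
    + by rewrite le_max FM// !homo_lt_le.
    + by rewrite le_max HN ?orbT.
    + exact: abs_continuous_comp_C1.
exists (h' \o f'); split; [exact: can_comp | exact: can_comp |].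
by exists (H' \o F'); [exact: is_lift_comp | exact: C1_comp].
Qed.

Lemma continuous_int_cst (K : R -> R) :
  continuous K -> (forall x, K x \is a Num.int) -> forall x y, K x = K y.
Proof.
move=> cK Kint.
suff le a b : a <= b -> K a = K b.
  by move=> x y; have [/le//|/ltW/le] := leP x y.
move=> ab; apply/eqP; apply: contraT => Kab.
have [m Km] := intrP (Kint a); have [n Kn] := intrP (Kint b).
have mn : m != n by apply: contra_neq Kab => mn; rewrite Km Kn mn.
have cK' : {within `[a, b], continuous K} by exact: continuous_subspaceT.
have [|c _ Kc] := IVT (v := Num.min (K a) (K b) + 2^-1) ab cK'.
  rewrite lerDl invr_ge0 ler0n/= Km Kn.
  have [mn'|nm'] := leP (m%:~R : R) n%:~R.
    have : (m + 1)%:~R <= n%:~R :> R.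
      by rewrite ler_int lezD1 lt_neqAle mn -(ler_int R).
    by rewrite intrD; lra.
  have : (n + 1)%:~R <= m%:~R :> R by rewrite ler_int lezD1 -(ltr_int R).
  by rewrite intrD; lra.
have [k Kk] := intrP (Kint c).
have [l Kl] : exists l : int, Num.min (K a) (K b) = l%:~R.
  by rewrite minEle; case: ifP => _; [exists m|exists n].
exfalso; move: Kc; rewrite Kk Kl => kl.
have lk : l < k by rewrite -(ltr_int R); lra.
have : k < l + 1 by rewrite -(ltr_int R) intrD; lra.
by rewrite ltzD1 leNgt lk.
Qed.

Lemma is_diff_circle_inv f g :
  is_diff_circle f -> cancel f g -> cancel g f -> is_diff_circle g.
Proof.
move=> [[F [fF incF CF acF]] [g' [fK' g'K [G gG CG]]]] fK gK.
have gg' : g' = g by apply/funext => x; rewrite -[x in LHS]gK fK'.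
rewrite {g'}gg' in fK' g'K gG.
split; last by exists f; split=> //; exists F.
have FGint x : F (G x) - x \is a Num.int.
  by apply/circle_projP; rewrite -fF -gG gK.
have cFG : continuous (fun x => F (G x) - x).
  move=> x; apply: cvgB; last exact: cvg_id.
  exact: (C1_continuous (C1_comp CF CG)).
have FGE x : F (G x) = x + F (G 0).
  by have := continuous_int_cst cFG FGint x 0; lra.
have incG : {homo G : x y / x < y}.
  move=> x y xy; rewrite ltNge; apply/negP => /(homo_lt_le incF).
  by rewrite (FGE x) (FGE y); lra.
exists G; split=> // a b.
have [N GN] := C1_bounded a b CG.
apply: (abs_continuousV (u := F^`()%classic \o G) (M := N)) => // [x xab|].
  rewrite /= -derive1_comp; [|exact: CG.1|exact: CF.1].
  have -> : F \o G = fun x => x + F (G 0) by apply/funext => y /=; exact: FGE.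
  by rewrite derive1E deriveD// derive_id derive_cst addr0.
exact: abs_continuous_comp_C1.
Qed.
End Circle.
Arguments circle : clear implicits.

Section DiffCircle.
Context {R : realType}.
Local Notation I := (`[0%R, 1%R]%classic : set R).

Record diff_circle : Type := DiffCircle {
  diff_circle_fun :> circle R -> circle R ;
  diff_circle_prop : is_diff_circle diff_circle_fun }.

Lemma diff_circle_ext (f g : diff_circle) : f =1 g -> f = g.
Proof.
case: f g => [f fP] [g gP] /= /funext fg; case: _ / fg in gP *.
by congr DiffCircle; exact: Prop_irrelevance.
Qed.

HB.instance Definition _ := gen_eqMixin diff_circle.
HB.instance Definition _ := gen_choiceMixin diff_circle.

Lemma diff_circle_inverse (f : diff_circle) :
  exists g : diff_circle, cancel f g /\ cancel g f.
Proof.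
have [_ [g [fK gK _]]] := diff_circle_prop f.
by exists (DiffCircle (is_diff_circle_inv (diff_circle_prop f) fK gK)).
Qed.

Definition diff_circle_one : diff_circle := DiffCircle (@is_diff_circle_id R).
Definition diff_circle_mul (f g : diff_circle) : diff_circle :=
  DiffCircle (is_diff_circle_comp (diff_circle_prop f) (diff_circle_prop g)).
Definition diff_circle_inv (f : diff_circle) : diff_circle :=
  sval (cid (diff_circle_inverse f)).

Lemma diff_circle_mulA : associative diff_circle_mul.
Proof. by move=> f g h; exact: diff_circle_ext. Qed.

Lemma diff_circle_mul1 : left_id diff_circle_one diff_circle_mul.
Proof. by move=> f; exact: diff_circle_ext. Qed.

Lemma diff_circle_mulr1 : right_id diff_circle_one diff_circle_mul.
Proof. by move=> f; exact: diff_circle_ext. Qed.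

Lemma diff_circle_mulV :
  left_inverse diff_circle_one diff_circle_inv diff_circle_mul.
Proof.
move=> f; apply: diff_circle_ext => x /=; rewrite /diff_circle_inv.
by case: cid => g [].
Qed.

Lemma diff_circle_mulrV :
  right_inverse diff_circle_one diff_circle_inv diff_circle_mul.
Proof.
move=> f; apply: diff_circle_ext => x /=; rewrite /diff_circle_inv.
by case: cid => g [].
Qed.

HB.instance Definition _ := isGroup.Build diff_circle
  diff_circle_mulA diff_circle_mul1 diff_circle_mulr1
  diff_circle_mulV diff_circle_mulrV.

(* The derivative of f at the class of x is F^`() x for any continuous lift F:
   see derive_circleE for the independence of the lift. *)
Definition derive_circle (f : diff_circle) : R -> R :=
  (sval (cid (diff_circle_prop f).1))^`()%classic.

Lemma derive_circleE (f : diff_circle) (F : R -> R) :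
  is_lift f F -> continuous F -> F^`()%classic = derive_circle f.
Proof.
rewrite /derive_circle; case: cid => /= G [fG _ CG _] fF cF.
have FGint x : F x - G x \is a Num.int by apply/circle_projP; rewrite -fF -fG.
have cFG : continuous (fun x => F x - G x).
  by move=> x; apply: cvgB; [exact: cF|exact: (C1_continuous CG)].
have -> : F = G + cst (F 0 - G 0).
  apply/funext => x; rewrite /= fctE.
  by have := continuous_int_cst cFG FGint x 0; rewrite /cst; lra.
apply/funext => x; rewrite !derive1E deriveD//; last exact: CG.1.
by rewrite derive_cst addr0.
Qed.

Definition rho_circle (f g : diff_circle) : R :=
  sup (range (fun p => circle_dist (f p) (g p))) +
  sup [set `|derive_circle f x - derive_circle g x| | x in I] +
  \int[lebesgue_measure]_(x in I)
    `|(derive_circle f)^`()%classic x - (derive_circle g)^`()%classic x|.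

HB.instance Definition _ := isOpenTopological.Build diff_circle
  (metric_openT rho_circle) (@metric_openI _ _ rho_circle)
  (@metric_open_bigU _ _ rho_circle).

Definition nonlinearity_dist_circle (f g : diff_circle) : R :=
  \int[lebesgue_measure]_(x in I)
    `|(derive_circle f)^`()%classic x / derive_circle f x -
      (derive_circle g)^`()%classic x / derive_circle g x|.

End DiffCircle.
Arguments diff_circle : clear implicits.

(* Main.v *)
(** Writing D f for the derivative, the bridge is that int |u'| over [0, 1] is the
    total variation of u when u is absolutely continuous; hence d (f, g) is the
    variation of ln (D f) - ln (D g), which is visibly invariant under
    reparametrization. When f fixes the base point, ln (D f) vanishes somewhere, so
    a small d (f, 1) forces f to be close to 1 in the C^1 + AC metric.
    For such an f, the diffeomorphisms g_k with D g_k proportional to (D f)^(k/N)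
    lead from 1 to f in N steps of d-length d (f, 1) / N. Any continuous
    right-invariant pseudometric is less than 1 on steps of d-length at most some
    delta, so it is at most d (f, 1) / delta + 1. On the circle a rotation is first
    split off, and rotations form a bounded set. *)
Require Import Defs.
From HB Require Import structures.
From mathcomp Require Import all_boot all_order all_algebra finmap.
From mathcomp Require Import all_classical all_reals all_analysis.
From mathcomp Require Import measurable_realfun ring lra.

Set Implicit Arguments.
Unset Strict Implicit.
Unset Printing Implicit Defensive.

Import Order.TTheory GRing.Theory Num.Theory.
Import numFieldNormedType.Exports.

Local Open Scope classical_set_scope.
Local Open Scope ring_scope.


(** * Absolute continuity and Lebesgue-Stieltjes measures *)

Section AbsContinuousFin.
Context {R : realType}.
Implicit Types (a b : R) (u v : R -> R).

(** The second derivatives under the integrals exist only almost everywhere and take arbitrary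
    values elsewhere, so each integrand is known only off a null set. Rewriting the integrals as
    variations removes this difficulty for good: afterwards every estimate compares increments of
    functions. The identity with the variation rests on Radon-Nikodym, applied to the Stieltjes
    measures of the monotone functions T - u and T + u, where T is the variation function of u.
    Logarithms are the right coordinate for two reasons. By the chain rule, right translation
    reparametrizes ln (D f) and adds a common summand that cancels in differences. Powers of D f
    become multiples of ln (D f), so consecutive g_k differ by ln (D f) / N plus a constant, which
    variation ignores. That constant comes from normalizing the total length; the mean value theorem
    recovers it, and a fixed base point then recovers a map from its derivative. Interval and circle
    share these properties, so the chain argument is carried out once, for an abstract group. *)

Lemma abs_continuous_fin a b u (e : R) : abs_continuous a b u -> 0 < e ->
  exists2 d, 0 < d & forall (I : finType) (s t : I -> R),
    (forall i, [/\ a <= s i, s i <= t i & t i <= b]) ->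
    (forall i j, i != j -> t i <= s j \/ t j <= s i) ->
    \sum_i (t i - s i) < d -> \sum_i `|u (t i) - u (s i)| < e.
Proof.
move=> acu e0; have [d d0 du] := acu e e0; exists d => // I s t st dj std.
have H := du #|I| (s \o enum_val) (t \o enum_val).
rewrite (reindex (enum_val (A := I))) /=; last first.
  by apply/onW_bij/enum_val_bij.
apply: H => [i|i j ij|].
- exact: st.
- by apply: dj; apply: contra_neq ij => /enum_val_inj.
- by move: std; rewrite (reindex (enum_val (A := I)))//; apply/onW_bij/enum_val_bij.
Qed.

Lemma lebesgue_stieltjes_itvoc (f : cumulative R R) (x y : R) : x <= y ->
  lebesgue_stieltjes_measure f `]x, y]%classic = (f y - f x)%:E.
Proof.
move=> xy; rewrite /lebesgue_stieltjes_measure /measure_extension.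
by rewrite measurable_mu_extE/= ?wlength_itv_bnd//; exact: is_ocitv.
Qed.

Lemma measurable_ocitv (X : set R) : ocitv X -> measurable (X : set (measurableTypeR R)).
Proof. by move=> oX; apply: sub_sigma_algebra. Qed.

(** An element of the ring is a finite disjoint union of half-open intervals, on which the two
    measures are the two sums in the definition of absolute continuity. *)
Lemma abs_continuous_stieltjes_ring (f : cumulative R R) a b (e : R) :
  abs_continuous a b f -> 0 < e -> exists2 d, 0 < d &
  forall U : set (measurableTypeR R), U `<=` `]a, b]%classic ->
    @measurable _ (SetRing.type (ocitv_type R)) U -> (lebesgue_measure U < d%:E)%E ->
    (lebesgue_stieltjes_measure f U <= e%:E)%E.
Proof.
move=> acf e0; have [d d0 du] := abs_continuous_fin acf e0; exists d => // U Uab mU Ud.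
have [D [finD D0 tD mD UE]] := SetRing.ring_finite_set mU.
pose F : {fset (set R)} := fset_set D.
have FD X : X \in F -> D X by rewrite in_fset_set// inE.
have mF X : X \in F -> @measurable _ (ocitv_type R) X.
  by move=> XF; apply: mD; rewrite inE; exact: FD.
have /choice[p pP] : forall X : F, exists p : R * R, [/\ p.1 < p.2, fsval X = `]p.1, p.2]%classic,
   a <= p.1 & p.2 <= b].
  move=> [X XF]/=; have [X0|[p p12 XE]] := (ocitvP X).1 (mF X XF).
    by have [x] := D0 _ (FD _ XF); rewrite X0.
  have Xab : X `<=` `]a, b]%classic.
    by apply: subset_trans Uab; rewrite UE; apply: bigcup_sup; exact: FD.
  exists p; split=> //.
    rewrite leNgt; apply/negP => p1a.
    have : X (Num.min a p.2).
      by rewrite XE/= in_itv/= lt_min p1a p12 ge_min lexx orbT.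
    by move=> /Xab/=; rewrite in_itv/= lt_min ltxx.
  have : X p.2 by rewrite XE/= in_itv/= p12 lexx.
  by move=> /Xab/=; rewrite in_itv/= => /andP[].
(* Needed twice: for [f], and for the identity, whose Stieltjes measure is Lebesgue measure. *)
have sumE (g : cumulative R R) : lebesgue_stieltjes_measure g U =
    (\sum_(X : F) (g (p X).2 - g (p X).1))%:E.
  rewrite UE measure_fin_bigcup//; last first.
    by move=> X DX; apply: measurable_ocitv; apply: mF; rewrite in_fset_set// inE.
  rewrite fsbig_finite// -/F big_seq_fsetE/= -sumEFin; apply: eq_bigr => X _.
  by have [/ltW p12 {1}-> _ _] := pP X; rewrite lebesgue_stieltjes_itvoc.
rewrite sumE lee_fin; apply: ltW; move: Ud; rewrite /lebesgue_measure sumE lte_fin => Ud.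
apply: le_lt_trans (du F (fun X => (p X).1) (fun X => (p X).2) _ _ Ud).
- by apply: ler_sum => X _; exact: ler_norm.
- by move=> X; have [/ltW ? _ ? ?] := pP X.
- move=> X Y XY.
  have [X12 XE _ _] := pP X; have [Y12 YE _ _] := pP Y.
  apply: contrapT => /not_orP[/negP + /negP]; rewrite -!ltNge => YX XY'.
  have := tD (fsval X) (fsval Y) (FD _ (fsvalP X)) (FD _ (fsvalP Y)).
  (* Overlapping intervals share the smaller of their right end points. *)
  have ne : (fsval X `&` fsval Y) (Num.min (p X).2 (p Y).2).
    by split; rewrite ?XE ?YE/= in_itv/= lt_min ge_min lexx ?orbT ?X12 ?Y12 ?YX ?XY'.
  move=> /(_ (ex_intro _ _ ne)) /val_inj XY1.
  by rewrite XY1 eqxx in XY.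
Qed.

(** Cover [A] by intervals of small total length, bound the finite unions by the ring lemma, and
    pass to the limit by continuity from below. *)
Lemma abs_continuous_stieltjes_null (f : cumulative R R) a b (A : set (measurableTypeR R)) :
  abs_continuous a b f -> measurable A -> A `<=` `]a, b]%classic ->
  lebesgue_measure A = 0%E -> lebesgue_stieltjes_measure f A = 0%E.
Proof.
move=> acf mA Aab A0; apply/eqP; rewrite eq_le measure_ge0 andbT.
apply/lee_addgt0Pr => e e0; rewrite add0e.
have [d d0 du] := abs_continuous_stieltjes_ring acf e0.
have : (lebesgue_measure A < d%:E)%E by rewrite A0 lte_fin.
(* Lebesgue measure is an infimum of total lengths of countable half-open covers. *)
move=> /ereal_inf_lt[_ [B [mB AB] <-]] Bd.
have oB k : ocitv (B k) by exact: mB.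
(* Absolute continuity is only known on [[a, b]], so the cover is cut down to []a, b]]. *)
pose C k := B k `&` `]a, b]%classic.
have oC k : ocitv (C k) by apply: ocitvI => //; exact: is_ocitv.
have mC k : measurable (C k : set (measurableTypeR R)) by apply: measurable_ocitv.
pose U n : set (measurableTypeR R) := \big[setU/set0]_(k < n) C k.
have mU n : measurable (U n) by apply: bigsetU_measurable => k _; exact: mC.
have UT : \bigcup_n U n = \bigcup_k C k.
  apply/seteqP; split=> [x [n _]|x [k _ Cx]].
    by rewrite /U -bigcup_mkord => -[k _ Cx]; exists k.
  by exists k.+1 => //; rewrite /U -bigcup_mkord; exists k => /=.
have mUT : measurable (\bigcup_n U n) by apply: bigcup_measurable.
have LU n : (lebesgue_stieltjes_measure f (U n) <= e%:E)%E.
  apply: du.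
  - by rewrite /U -bigcup_mkord; apply: bigcup_sub => k _ x [].
  - apply: (@bigsetU_measurable (SetRing.display (ocitv_display R)) (SetRing.type (ocitv_type R))) => k _.
    by apply: SetRing.measurable_subring; exact: oC.
  - apply: le_lt_trans Bd; apply: (@le_trans _ _ (\sum_(k < n) lebesgue_measure (C k))%E).
      by apply: content_subadditive.
    apply: (@le_trans _ _ (\sum_(k < n) wlength idfun (B k))%E); last first.
      rewrite -(big_mkord xpredT (fun k => wlength idfun (B k))).
      by apply: nneseries_lim_ge => k _ _; exact: (@wlength_ge0 R idfun).
    apply: lee_sum => k _; have -> : wlength idfun (B k) = lebesgue_measure (B k).
      by rewrite /lebesgue_measure /lebesgue_stieltjes_measure /measure_extension measurable_mu_extE.
    apply: le_measure; rewrite ?inE//; [exact: measurable_ocitv|exact: subIsetl].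
apply: (@le_trans _ _ (lebesgue_stieltjes_measure f (\bigcup_n U n))).
  apply: le_measure; rewrite ?inE// UT => x Ax; have [k _ Bkx] := AB _ Ax.
  by exists k => //; split=> //; exact: Aab.
have ndU : nondecreasing_seq U by move=> i j ij; exact/subsetPset/subset_bigsetU.
have cU := nondecreasing_cvg_mu (mu := lebesgue_stieltjes_measure f) mU mUT ndU.
rewrite -(cvg_lim _ cU)//; apply: lime_le; first by apply/cvg_ex; eexists; exact: cU.
by apply: nearW.
Qed.

End AbsContinuousFin.

(** * Densities of monotone absolutely continuous functions *)

Section Monotone.
Context {R : realType}.
Implicit Types (a b x : R) (u v g : R -> R).
Local Notation leb := (@lebesgue_measure R).

Lemma abs_continuous_modulus a b u (e : R) : abs_continuous a b u -> 0 < e ->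
  exists2 d, 0 < d & forall x y, a <= x <= b -> a <= y <= b -> `|x - y| < d ->
    `|u x - u y| < e.
Proof.
move=> acu e0; have [d d0 du] := acu e e0; exists d => //.
suff H x y : a <= x -> x <= y -> y <= b -> y - x < d -> `|u y - u x| < e.
  move=> x y /andP[ax xb] /andP[ay yb].
  have [xy|/ltW yx] := leP x y.
    by rewrite distrC (ger0_norm (_ : 0 <= y - x)) ?subr_ge0// distrC => ?; apply: H.
  by rewrite (ger0_norm (_ : 0 <= x - y)) ?subr_ge0// => ?; apply: H.
move=> ax xy yb xyd.
have := du 1%N (fun=> x) (fun=> y); rewrite !big_ord1; apply => //.
by move=> i j; rewrite !ord1 eqxx.
Qed.

(** Precomposition with this retraction extends a function from [[a, b]] to the line by its end
    values, keeping it continuous and monotone. *)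
Definition clamp a b x : R := Num.max a (Num.min b x).

Lemma clamp_itv a b x : a <= b -> a <= clamp a b x <= b.
Proof. by move=> ab; rewrite /clamp le_max lexx/= ge_max ab ge_min lexx. Qed.

Lemma clamp_id a b x : a <= x <= b -> clamp a b x = x.
Proof. by move=> /andP[ax xb]; rewrite /clamp min_r// max_r. Qed.

Lemma clamp_le a b x y : x <= y -> clamp a b x <= clamp a b y.
Proof.
by move=> xy; rewrite /clamp ge_max !le_max !le_min !ge_min !lexx xy !orbT.
Qed.

Lemma clamp_dist a b x y : `|clamp a b x - clamp a b y| <= `|x - y|.
Proof.
wlog xy : x y / x <= y.
  move=> H; have [|/ltW] := leP x y; first exact: H.
  by move=> /H; rewrite distrC (distrC y).
rewrite distrC (distrC x) !ger0_norm ?subr_ge0//; last exact: clamp_le.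
rewrite /clamp; case: (leP b x) => bx; case: (leP b y) => by_;
  case: (leP a b) => ab; case: (leP a x) => ax; case: (leP a y) => ay; lra.
Qed.

Lemma abs_continuous_clamp a b u : a <= b -> abs_continuous a b u ->
  continuous (u \o clamp a b).
Proof.
move=> ab acu x; apply/cvgrPdist_lt => e e0.
have [d d0 du] := abs_continuous_modulus acu e0.
near=> y; apply: du; rewrite ?clamp_itv//.
apply: le_lt_trans (clamp_dist _ _ _ _) _.
by near: y; exact: (nbhsx_ballx x d d0).
Unshelve. all: by end_near. Qed.

(** Lebesgue differentiation of the indefinite integral, transferred to [v], which is known to agree
    with it up to a constant only on [[a, b]]. *)
Lemma FTC1_ae a b v g : leb.-integrable setT (EFin \o g) ->
  (forall x, a <= x <= b -> v x - v a = \int[leb]_(t in `]a, x]) g t) ->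
  {ae leb, forall x, a < x < b -> derivable v x 1 /\ v^`()%classic x = g x}.
Proof.
move=> ig vE.
have lg : locally_integrable setT g.
  by apply: open_integrable_locally => //; exact: openT.
have ig' y : leb.-integrable [set` Interval (BRight a) (BRight y)] (EFin \o g).
  by apply: integrableS ig.
have := FTC1 ig' lg; apply: filterS; first exact: (ae_filter_ringOfSetsType leb).
move=> x H /andP[ax xb].
have [] := H ax.
set F := fun x => _ => dF FE.
have vF : \forall y \near x, v a + F y = v y.
  near=> y; rewrite /F -vE ?subrKC ?addrC ?subrK//.
  apply/andP; split; apply: ltW; near: y; [exact: lt_nbhsr|exact: lt_nbhsl].
have dF' : is_derive x 1 F (g x) by rewrite -FE derive1E; apply: DeriveDef.
have [dv vE'] := near_eq_is_derive vF (is_deriveD (is_derive_cst (v a) x 1) dF').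
by split; [exact: dv|rewrite derive1E vE' add0r].
Unshelve. all: by end_near. Qed.

(** The density is the Radon-Nikodym derivative of the Stieltjes measure of [v]; absolute continuity
    of [v] makes that measure vanish on Lebesgue null sets. *)
Lemma nondecreasing_abs_continuous_integral a b v : a <= b ->
  (forall x y, a <= x -> x <= y -> y <= b -> v x <= v y) -> abs_continuous a b v ->
  exists g : R -> R, [/\ forall x, 0 <= g x, leb.-integrable setT (EFin \o g) &
    forall x, a <= x <= b -> v x - v a = \int[leb]_(t in `]a, x]) g t].
Proof.
move=> ab ndv acv; pose V := v \o clamp a b.
have VE x : a <= x <= b -> V x = v x by move=> xab; rewrite /V /= clamp_id.
have ndV : {homo V : x y / x <= y}.
  move=> x y xy; have /andP[ax _] := clamp_itv x ab; have /andP[_ yb] := clamp_itv y ab.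
  by apply: ndv => //; exact: clamp_le.
have rcV := right_continuousW (abs_continuous_clamp ab acv).
pose cV := isCumulative.Build R _ R V ndV rcV.
pose W : cumulative R R := HB.pack V cV.
have acV : abs_continuous a b W.
  by apply: eq_abs_continuous acv => x xab; rewrite -VE.
have mab : measurable (`]a, b]%classic : set (measurableTypeR R)) by [].
have nuab : (lebesgue_stieltjes_measure W `]a, b]%classic < +oo)%E.
  by rewrite lebesgue_stieltjes_itvoc// ltry.
(* Restricting to []a, b]] makes the measure finite and confines it to where absolute continuity is
   known. *)
pose nu := mfrestr mab nuab.
have nuleb : nu `<< leb.
  move=> A /= A0 B mB BA; apply: (abs_continuous_stieltjes_null acV).
  - exact: measurableI.
  - exact: subIsetr.
  - apply: A0; first exact: measurableI.
    by apply: subset_trans BA; exact: subIsetl.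
have [g [g0 gfin ig gE]] := @radon_nikodym_sigma_finite _ _ _ leb nu nuleb.
have EFing : EFin \o (fine \o g) = g by apply/funext => x /=; rewrite fineK.
exists (fine \o g); split.
- by move=> x /=; rewrite fine_ge0.
- by rewrite EFing.
- move=> x /andP[ax xb]; rewrite /Rintegral.
  have -> : (\int[leb]_(t in `]a, x]) ((fine \o g) t)%:E)%E = (\int[leb]_(t in `]a, x]) g t)%E.
    by apply: eq_integral => t _ /=; rewrite fineK.
  have mx : measurable (`]a, x]%classic : set (measurableTypeR R)) by [].
  rewrite -(gE _ mx).
  change (v x - v a = fine (lebesgue_stieltjes_measure W (`]a, x]%classic `&` `]a, b]%classic))).
  rewrite setIidl; last by apply: subset_itvl; rewrite bnd_simp.
  rewrite lebesgue_stieltjes_itvoc//.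
  by rewrite -(VE x) ?ax// -(VE a) ?lexx.
Qed.

End Monotone.

(** * Total variation of absolutely continuous functions *)

Section TotalVariationAC.
Context {R : realType}.
Implicit Types (a b x y : R) (u : R -> R) (s : seq R).

Lemma itv_partition_node_le x y s i j : itv_partition x y s ->
  (i <= j)%N -> (j <= size s)%N -> nth y (x :: s) i <= nth y (x :: s) j.
Proof.
move=> [xs _] ij js.
have xs' : sorted <=%O (x :: s) by apply: sub_path xs => ? ? /ltW.
by apply: (le_sorted_leq_nth y xs') => //; rewrite inE/= ltnS// (leq_trans ij).
Qed.

Lemma itv_partition_node_itv x y s i : itv_partition x y s -> (i <= size s)%N ->
  x <= nth y (x :: s) i <= y.
Proof.
move=> xys si; apply/andP; split.
  exact: (itv_partition_node_le (i := 0) xys).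
have yE : nth y (x :: s) (size s) = y.
  by case: xys => _ /eqP; rewrite (last_nth y).
by rewrite -[leRHS]yE; exact: itv_partition_node_le.
Qed.

Lemma itv_partition_telescope x y s : itv_partition x y s ->
  \sum_(i < size s) (nth y (x :: s) i.+1 - nth y (x :: s) i) = y - x.
Proof.
move=> [_ /eqP xs]; rewrite -(big_mkord xpredT (fun i => nth y (x :: s) i.+1 - nth y (x :: s) i)).
by rewrite telescope_sumr//= -[in RHS]xs (last_nth y).
Qed.

(** The pieces of any partition form one disjoint family of total length [y - x], so the same [d]
    serves all partitions. *)
Lemma abs_continuous_TV_small a b u (e : R) : abs_continuous a b u -> 0 < e ->
  exists2 d, 0 < d & forall x y, a <= x -> x <= y -> y <= b -> y - x < d ->
    (total_variation x y u <= e%:E)%E.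
Proof.
move=> acu e0; have [d d0 du] := acu e e0; exists d => // x y ax xy yb xyd.
apply: ge_ereal_sup => _ [_ [s xys <-] <-]; rewrite lee_fin /variation/= big_mkord ltW//.
apply: (du _ (fun i => nth y (x :: s) i) (fun i => nth y (x :: s) i.+1)).
- move=> i; have /andP[? ?] := itv_partition_node_itv xys (ltn_ord i).
  have /andP[? ?] := itv_partition_node_itv xys (ltnW (ltn_ord i)).
  split; [exact: le_trans ax _|exact: (itv_partition_node_le xys)|exact: le_trans yb].
- move=> i j; rewrite neq_ltn => /orP[ij|ji]; [left|right].
    by apply: itv_partition_node_le => //; exact: ltnW.
  by apply: itv_partition_node_le => //; exact: ltnW.
- by rewrite itv_partition_telescope.
Qed.

(** Steps of length [d / 2] exhaust [[a, b]] after finitely many moves, each adding at most 1 to the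
    variation. *)
Lemma abs_continuous_BV a b u : a <= b -> abs_continuous a b u ->
  bounded_variation a b u.
Proof.
move=> ab acu; apply/(bounded_variationP _ ab).
have [d d0 du] := abs_continuous_TV_small acu ltr01.
suff H n x : a <= x <= b -> x <= a + n%:R * (d / 2) ->
    (total_variation a x u <= n%:R%:E)%E.
  rewrite ge0_fin_numE ?total_variation_ge0//.
  pose n := Num.bound ((b - a) / (d / 2)).
  apply: (@le_lt_trans _ _ n%:R%:E); last exact: ltry.
  apply: H; first by rewrite ab lexx.
  have d20 : 0 < d / 2 by rewrite divr_gt0.
  rewrite -lerBlDl -ler_pdivrMr// ltW// archi_boundP//.
  by apply: divr_ge0; [rewrite subr_ge0|exact: ltW].
elim: n x => [|n IH] x /andP[ax xb].
  rewrite mul0r addr0 => xa; have -> : x = a by apply/eqP; rewrite eq_le xa ax.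
  by rewrite total_variationxx.
move=> xn; have [xn'|nx] := leP x (a + n%:R * (d / 2)).
  by apply: (le_trans (IH _ _ xn')); rewrite ?ax// lee_fin ler_nat.
have n0 : 0 <= n%:R * (d / 2) by rewrite mulr_ge0// divr_ge0// ltW.
rewrite (@total_variationD _ _ _ (a + n%:R * (d / 2)))//; [|lra|exact: ltW].
rewrite -[n.+1%:R]natr1 EFinD; apply: leeD.
  by apply: IH => //; apply/andP; split; lra.
apply: du => //; [lra|exact: ltW|].
by move: xn; rewrite -[n.+1%:R]natr1 mulrDl mul1r; lra.
Qed.

Lemma TV_fin_num a b x y u : bounded_variation a b u -> a <= x -> x <= y -> y <= b ->
  total_variation x y u \is a fin_num.
Proof.
move=> bvu ax xy yb; apply/bounded_variationP => //.
by apply: (bounded_variationl xy yb); apply: (bounded_variationr ax _ bvu); exact: le_trans yb.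
Qed.

Lemma fine_TVD a b x y z u : bounded_variation a b u ->
  a <= x -> x <= y -> y <= z -> z <= b ->
  fine (total_variation x z u) = fine (total_variation x y u) + fine (total_variation y z u).
Proof.
move=> bvu ax xy yz zb; rewrite (total_variationD _ xy yz) fineD//.
  by apply: (TV_fin_num bvu) => //; exact: le_trans zb.
by apply: (TV_fin_num bvu) => //; exact: le_trans xy.
Qed.

Lemma TV_approx x y u (e : R) : x <= y -> total_variation x y u \is a fin_num -> 0 < e ->
  exists2 s, itv_partition x y s & fine (total_variation x y u) <= variation x y u s + e.
Proof.
rewrite le_eqVlt => /predU1P[<- _ e0|xy fu e0].
  exists [::]; first by split => //=.
  by rewrite total_variationxx/= addr_ge0 ?variation_ge0// ltW.
have [_ [_ [s xys <-] <-] sV] := ub_ereal_sup_adherent e0 fu.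
exists s => //; rewrite -lerBlDr -lee_fin EFinB fineK//; exact: ltW.
Qed.

(** Inside each [[s i, t i]] take a partition that nearly attains the variation. All the pieces
    together form one disjoint family with the same total length, to which absolute continuity of
    [u] applies. *)
Lemma abs_continuous_TV a b u : a <= b -> abs_continuous a b u ->
  abs_continuous a b (fun x => fine (total_variation a x u)).
Proof.
move=> ab acu e e0.
have bvu := abs_continuous_BV ab acu.
have e20 : 0 < e / 2 by rewrite divr_gt0.
have [d d0 du] := abs_continuous_fin acu e20; exists d => // n s t st dj std.
(* The error allowed per interval; dividing by [n.+1] keeps it positive and meaningful when [n] is
   0. *)
pose h : R := (e / 2) / n.+1%:R.
have h0 : 0 < h by rewrite divr_gt0.
have /choice[l lP] : forall i, exists l, itv_partition (s i) (t i) l /\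
    fine (total_variation (s i) (t i) u) <= variation (s i) (t i) u l + h.
  move=> i; have [as_ s_t tb] := st i.
  by have [l ? ?] := TV_approx s_t (TV_fin_num bvu as_ s_t tb) h0; exists l.
pose J (i : 'I_n) : finType := 'I_(size (l i)).
pose lo (p : {i : 'I_n & J i}) := nth (t (tag p)) (s (tag p) :: l (tag p)) (tagged p).
pose hi (p : {i : 'I_n & J i}) := nth (t (tag p)) (s (tag p) :: l (tag p)) (tagged p).+1.
have lohi p : [/\ s (tag p) <= lo p, lo p <= hi p & hi p <= t (tag p)].
  have xys := (lP (tag p)).1; have kl := ltn_ord (tagged p).
  have /andP[? ?] := itv_partition_node_itv xys kl.
  have /andP[? ?] := itv_partition_node_itv xys (ltnW kl).
  by split=> //; exact: (itv_partition_node_le xys).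
have sumJ (F : forall i, J i -> R) :
    \sum_(i < n) \sum_(j : J i) F i j = \sum_(p : {i : 'I_n & J i}) F (tag p) (tagged p).
  by rewrite sig_big_dep.
have VE : \sum_(i < n) variation (s i) (t i) u (l i) =
    \sum_(p : {i : 'I_n & J i}) `|u (hi p) - u (lo p)|.
  rewrite -(sumJ (fun i (j : J i) =>
    `|u (nth (t i) (s i :: l i) j.+1) - u (nth (t i) (s i :: l i) j)|)).
  by apply: eq_bigr => i _; rewrite /variation big_mkord.
have LE : \sum_(i < n) (t i - s i) = \sum_(p : {i : 'I_n & J i}) (hi p - lo p).
  rewrite -(sumJ (fun i (j : J i) =>
    nth (t i) (s i :: l i) j.+1 - nth (t i) (s i :: l i) j)).
  by apply: eq_bigr => i _; rewrite itv_partition_telescope//; exact: (lP i).1.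
have Vlt : \sum_(i < n) variation (s i) (t i) u (l i) < e / 2.
  rewrite VE; apply: du; last by rewrite -LE.
    move=> p; have [? ? ?] := lohi p; have [? ? ?] := st (tag p).
    by split=> //; lra.
  (* Pieces of one partition are ordered by their index; pieces of different ones inherit
     disjointness from the intervals. *)
  move=> [i k] [j m] ne; have [ij|ij] := eqVneq i j.
    subst j; have km : k != m by apply: contra_neq ne => ->.
    move: km; rewrite /lo /hi/= neq_ltn => /orP[km|mk]; [left|right].
      exact: (@itv_partition_node_le _ _ _ (nat_of_ord k).+1 _ (lP i).1 km (ltnW (ltn_ord m))).
    exact: (@itv_partition_node_le _ _ _ (nat_of_ord m).+1 _ (lP i).1 mk (ltnW (ltn_ord k))).
  have [/= ? ? ?] := lohi (Tagged J k); have [/= ? ? ?] := lohi (Tagged J m).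
  by have [tisj|tjsi] := dj i j ij; [left|right]; lra.
apply: (@le_lt_trans _ _ (\sum_(i < n) (variation (s i) (t i) u (l i) + h))).
  apply: ler_sum => i _; have [as_ s_t tb] := st i.
  rewrite (fine_TVD bvu (lexx a) as_ s_t tb) addrAC subrr add0r.
  by rewrite ger0_norm ?(lP i).2// fine_ge0// total_variation_ge0.
rewrite big_split/= sumr_const card_ord.
have : h *+ n <= e / 2.
  have -> : h *+ n = (e / 2) * (n%:R / n.+1%:R).
    by rewrite -[h *+ n]mulr_natr /h mulrAC -!mulrA.
  rewrite ler_piMr ?(ltW e20)// ler_pdivrMr// mul1r.
  by rewrite ler_nat.
by lra.
Qed.

End TotalVariationAC.

(** * Integrals of functions known only off a null set *)

Section NonmeasurableIntegral.
Context {d} {T : measurableType d} {R : realType} (mu : {measure set T -> \bar R}).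
Local Open Scope ereal_scope.
Import HBNNSimple.

(* The integral of a non-measurable nonnegative function is its lower integral;
   it still only depends on the function up to a null set. *)
Lemma ge0_eq_integral_negligible (D N : set T) (p q : T -> \bar R) :
  measurable D -> measurable N -> mu N = 0 -> measurable_fun D q ->
  (forall x, D x -> 0 <= p x) -> (forall x, D x -> 0 <= q x) ->
  (forall x, D x -> ~ N x -> p x = q x) ->
  \int[mu]_(x in D) p x = \int[mu]_(x in D) q x.
Proof.
move=> mD mN N0 mq p0 q0 pq; apply/eqP; rewrite eq_le; apply/andP; split.
  (* Only the simple functions below [p] are measurable, so the null set is discarded from their
     integrals, not from that of [p]. *)
  rewrite ge0_integralE//; apply: ge_ereal_sup => _ [h /= hp <-].
  have hm : measurable_fun setT (EFin \o h) by exact/measurable_EFinP.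
  have <- : \int[mu]_x (h x)%:E = sintegral mu h.
    by rewrite integral_nnsfun// patch_setT.
  rewrite (ge0_negligible_integral mN measurableT hm)//; last first.
    by move=> x _; rewrite lee_fin.
  rewrite (ge0_negligible_integral mN mD mq q0 N0) integral_mkcond [leRHS]integral_mkcond.
  apply: ge0_le_integral => //.
  - by move=> x _; apply: erestrict_ge0 => y _; rewrite lee_fin.
  - apply/(measurable_restrictT _ _).1; first exact: measurableD.
    exact: measurable_funS hm.
  - apply/(measurable_restrictT _ _).1; first exact: measurableD.
    by apply: measurable_funS mq => //; exact: subDsetl.
  - move=> x _; rewrite /patch !in_setD in_setT/=; case: ifPn => xN /=.
      have [xD|xD] := boolP (x \in D) => /=.
        rewrite -pq//; last by move: xN; rewrite notin_setE.
          by have := hp x; rewrite /patch xD.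
        by rewrite inE in xD.
      by have := hp x; rewrite /patch (negbTE xD).
    by rewrite andbF.
rewrite (ge0_negligible_integral mN mD mq q0 N0) ge0_integralE; last first.
  by move=> x [Dx _]; exact: q0.
rewrite [leRHS]ge0_integralE//.
apply: ge_ereal_sup => _ [h /= hq <-]; apply: ereal_sup_ubound; exists h => // x /=.
apply: (le_trans (hq x)); rewrite /patch in_setD.
have [xD|xD] := boolP (x \in D) => /=; last by [].
have [xN|xN] := boolP (x \in N) => /=; first by apply: p0; rewrite inE in xD.
rewrite pq//; first by rewrite inE in xD.
by move: xN; rewrite notin_setE.
Qed.

End NonmeasurableIntegral.

(** * Variation as the integral of the absolute derivative *)

Section TotalVariationIntegral.
Context {R : realType}.
Implicit Types (a b x y : R) (u v w g : R -> R).
Local Notation leb := (@lebesgue_measure R).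

Lemma fine_TV_ge a b u x y : bounded_variation a b u -> a <= x -> x <= y -> y <= b ->
  `|u y - u x| <= fine (total_variation x y u).
Proof.
move=> bvu ax xy yb; rewrite -lee_fin fineK; last exact: TV_fin_num bvu _ _ _.
exact: total_variation_ge.
Qed.

Lemma fine_TV_ge0 a b u : a <= b -> 0 <= fine (total_variation a b u).
Proof. by move=> ab; rewrite fine_ge0// total_variation_ge0. Qed.

(** The analogue of [abs_continuous_dom] for variation, proved termwise on partition sums. All later
    bounds on [unit_TV] under algebraic operations, [ln] and [expR] go through it. *)
Lemma TV_dom a b u v w (K L : R) : a <= b -> 0 <= K -> 0 <= L ->
  bounded_variation a b u -> bounded_variation a b v ->
  (forall x y, a <= x -> x <= y -> y <= b ->
     `|w y - w x| <= K * `|u y - u x| + L * `|v y - v x|) ->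
  bounded_variation a b w /\ fine (total_variation a b w) <=
    K * fine (total_variation a b u) + L * fine (total_variation a b v).
Proof.
move=> ab K0 L0 bvu bvv wuv.
have fu := (bounded_variationP u ab).1 bvu; have fv := (bounded_variationP v ab).1 bvv.
have leV f s : total_variation a b f \is a fin_num -> itv_partition a b s ->
    variation a b f s <= fine (total_variation a b f).
  move=> ff abs; rewrite -lee_fin fineK//; apply: ereal_sup_ubound.
  by exists (variation a b f s) => //; exact: variations_variation.
have H : (total_variation a b w <= (K * fine (total_variation a b u) +
    L * fine (total_variation a b v))%:E)%E.
  apply: ge_ereal_sup => _ [_ [s abs <-] <-]; rewrite lee_fin.
  apply: (@le_trans _ _ (K * variation a b u s + L * variation a b v s)); last first.
    by apply: lerD; apply: ler_wpM2l => //; exact: leV.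
  rewrite /variation/= !big_mkord !mulr_sumr -big_split/=; apply: ler_sum => i _.
  have /andP[? ?] := itv_partition_node_itv abs (ltn_ord i).
  have /andP[? ?] := itv_partition_node_itv abs (ltnW (ltn_ord i)).
  by apply: wuv => //; exact: (itv_partition_node_le abs (leqnSn i)).
have fw : total_variation a b w \is a fin_num.
  by rewrite ge0_fin_numE ?total_variation_ge0//; apply: le_lt_trans H _; exact: ltry.
split; first exact/(bounded_variationP w ab).
by rewrite -lee_fin fineK.
Qed.

(** Jordan decomposition: [T - u] and [T + u] are nondecreasing and absolutely continuous, hence
    have densities [g2] and [g3], and [u] is half the difference of [T + u] and [T - u]. *)
Lemma abs_continuous_integral a b u : a <= b -> abs_continuous a b u ->
  exists g : R -> R, [/\ leb.-integrable setT (EFin \o g),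
    forall x, a <= x <= b -> u x - u a = \int[leb]_(t in `]a, x]) g t &
    fine (total_variation a b u) = \int[leb]_(t in `]a, b]) `|g t|].
Proof.
move=> ab acu; pose T x := fine (total_variation a x u).
have bvu := abs_continuous_BV ab acu.
have acT : abs_continuous a b T := abs_continuous_TV ab acu.
have TE x y : a <= x -> x <= y -> y <= b -> T y - T x = fine (total_variation x y u).
  by move=> ax xy yb; rewrite /T (fine_TVD bvu (lexx a) ax xy yb) addrAC subrr add0r.
have Tu x y : a <= x -> x <= y -> y <= b -> `|u y - u x| <= T y - T x.
  by move=> ax xy yb; rewrite TE//; exact: fine_TV_ge bvu _ _ _.
have T0 x y : a <= x -> x <= y -> y <= b -> `|T y - T x| = T y - T x.
  by move=> ax xy yb; rewrite ger0_norm// TE// fine_TV_ge0.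
have acB : abs_continuous a b (fun x => T x - u x).
  apply: (abs_continuous_dom acT acu (K := 1) (L := 1)) => x y _ _ _.
  have -> : T y - u y - (T x - u x) = (T y - T x) - (u y - u x) by ring.
  by rewrite !mul1r ler_normB.
have acD : abs_continuous a b (fun x => T x + u x).
  apply: (abs_continuous_dom acT acu (K := 1) (L := 1)) => x y _ _ _.
  have -> : T y + u y - (T x + u x) = (T y - T x) + (u y - u x) by ring.
  by rewrite !mul1r ler_normD.
have [g2 [g20 ig2 g2E]] : exists g : R -> R, [/\ forall x, 0 <= g x, leb.-integrable setT (EFin \o g) &
    forall x, a <= x <= b -> (T x - u x) - (T a - u a) = \int[leb]_(t in `]a, x]) g t].
  apply: (nondecreasing_abs_continuous_integral ab _ acB) => x y ax xy yb.
  by have := Tu x y ax xy yb; have := ler_norm (u y - u x); lra.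
have [g3 [g30 ig3 g3E]] : exists g : R -> R, [/\ forall x, 0 <= g x, leb.-integrable setT (EFin \o g) &
    forall x, a <= x <= b -> (T x + u x) - (T a + u a) = \int[leb]_(t in `]a, x]) g t].
  apply: (nondecreasing_abs_continuous_integral ab _ acD) => x y ax xy yb.
  by have := Tu x y ax xy yb; have := ler_norm (- (u y - u x)); rewrite normrN; lra.
pose g x := 2^-1 * (g3 x - g2 x).
have mitv x : measurable (`]a, x]%classic : set (measurableTypeR R)) by [].
have igB : leb.-integrable setT (EFin \o (g3 \- g2)) by exact: (integrableB measurableT ig3 ig2).
have igD : leb.-integrable setT (EFin \o (g3 \+ g2)) by exact: (integrableD measurableT ig3 ig2).
have ig : leb.-integrable setT (EFin \o g) by exact: (integrableZl measurableT 2^-1 igB).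
have iS f x y : leb.-integrable setT (EFin \o f) -> leb.-integrable [set` Interval (BRight x) (BRight y)] (EFin \o f).
  by move=> fi; apply: integrableS fi.
have gE x : a <= x <= b -> u x - u a = \int[leb]_(t in `]a, x]) g t.
  move=> xab; rewrite RintegralZl//; last exact: iS.
  rewrite RintegralB//; [|exact: iS|exact: iS].
  by rewrite -g2E// -g3E//; field.
exists g; split=> //.
have iN : leb.-integrable setT (EFin \o (fun x => `|g x|)) by exact: integrable_norm.
apply/eqP; rewrite eq_le; apply/andP; split; last first.
  have Ta : T a = 0 by rewrite /T total_variationxx.
  (* The density [(g2 + g3) / 2] of [T] dominates the absolute value of [g], since [g2] and [g3] are
     nonnegative. *)
  have -> : fine (total_variation a b u) = \int[leb]_(t in `]a, b]) (2^-1 * (g3 t + g2 t)).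
    rewrite RintegralZl//; last exact: (iS _ _ _ igD).
    rewrite RintegralD//; [|exact: iS|exact: iS].
    by rewrite -g2E ?ab ?lexx// -g3E ?ab ?lexx// -/(T b) Ta; field.
  apply: le_Rintegral => //; [exact: iS|exact: (iS _ _ _ (integrableZl measurableT 2^-1 igD))|].
  move=> x _; rewrite /g normrM ger0_norm// ler_wpM2l//.
  by rewrite ler_norml; have := g20 x; have := g30 x; move=> *; apply/andP; split; lra.
(* Conversely, increments of [u] are dominated by those of the nondecreasing [G], whose variation is
   [G b - G a]. *)
pose G x := \int[leb]_(t in `]a, x]) `|g t|.
have GB x y : a <= x -> x <= y -> y <= b -> `|u y - u x| <= G y - G x.
  move=> ax xy yb.
  have -> : u y - u x = (u y - u a) - (u x - u a) by ring.
  rewrite !gE; [|by apply/andP; split; lra|by apply/andP; split; lra].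
  rewrite /G !Rintegral_itvB ?bnd_simp//; [|exact: iS|exact: iS].
  by apply: le_normr_Rintegral => //; exact: iS.
have Gnd : {in `[a, b] &, nondecreasing_fun G}.
  move=> x y; rewrite !in_itv/= => /andP[ax xb] /andP[ay yb] xy.
  by have := GB x y ax xy yb; have := normr_ge0 (u y - u x); lra.
have Ga : G a = 0 by rewrite /G set_itv_ge ?bnd_simp ?ltxx// Rintegral_set0.
have := nondecreasing_total_variation ab Gnd; rewrite Ga subr0 => TG.
have bvG : bounded_variation a b G by apply/(bounded_variationP _ ab); rewrite TG.
have := (@TV_dom a b G G u 1 0 ab ler01 (lexx 0) bvG bvG).
rewrite TG/= mul1r mul0r addr0; case => //.
move=> x y ax xy yb; rewrite mul1r mul0r addr0.
by apply: le_trans (GB x y ax xy yb) _; exact: ler_norm.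
Qed.

Lemma abs_continuous_ae_derivable a b u : a <= b -> abs_continuous a b u ->
  {ae leb, forall x, a < x < b -> derivable u x 1}.
Proof.
move=> ab acu; have [g [ig gE _]] := abs_continuous_integral ab acu.
apply: filterS (FTC1_ae ig gE); first exact: (ae_filter_ringOfSetsType leb).
by move=> x H /H[].
Qed.

(** [p] is constrained only almost everywhere and only where [u] is derivable: this is the form in
    which a second derivative with arbitrary values on a null set can be plugged in. *)
Lemma TV_integral a b u (p : R -> R) : a <= b -> abs_continuous a b u ->
  (forall x, 0 <= p x) ->
  {ae leb, forall x, a < x < b -> derivable u x 1 -> p x = `|u^`()%classic x|} ->
  \int[leb]_(x in `[a, b]) p x = fine (total_variation a b u).
Proof.
move=> ab acu p0 pE; have [g [ig gE ->]] := abs_continuous_integral ab acu.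
have [N [mN N0 NE]] : {ae leb, forall x, a < x < b -> p x = `|g x|}.
  apply: filterS2 pE (FTC1_ae ig gE); first exact: (ae_filter_ringOfSetsType leb).
  by move=> x xp xg xab; have [dx <-] := xg xab; exact: xp.
have iN : leb.-integrable setT (EFin \o (fun x => `|g x|)) by exact: integrable_norm.
have iNab : leb.-integrable `]a, b] (EFin \o (fun x => `|g x|)) by exact: integrableS iN.
have mab : measurable ([set a; b] : set (measurableTypeR R)) by apply: measurableU.
have Nab0 : leb (N `|` [set a; b]) = 0%E.
  apply/eqP; rewrite eq_le measure_ge0 andbT.
  apply: (@le_trans _ _ (leb N + (leb [set a] + leb [set b]))%E).
    apply: (@le_trans _ _ (leb N + leb [set a; b])%E); first exact: measureU2.
    by apply: leeD => //; exact: measureU2.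
  by rewrite N0 !lebesgue_measure_set1 !adde0.
rewrite (Rintegral_itv_obnd_cbnd iNab) /Rintegral; congr fine.
apply: (@ge0_eq_integral_negligible _ _ _ leb _ (N `|` [set a; b])) => //.
- by apply: measurableU => //; apply: measurableU.
- by apply: measurable_funS (measurable_int _ iN).
- by move=> x _; rewrite lee_fin.
- move=> x /=; rewrite in_itv/= => /andP[ax xb] /not_orP[Nx /not_orP[xa xb']].
  have xab : a < x < b by rewrite !lt_neqAle ax xb !andbT eq_sym; apply/andP; split; exact/eqP.
  have /contrapT/(_ xab)-> // : ~ ~ (a < x < b -> p x = `|g x|).
  by apply: contra_not Nx => ?; apply: NE.
Qed.

End TotalVariationIntegral.

(** * Maximality from a chain of small steps *)

Section Estimates.
Context {R : realType}.
Implicit Types (a b x y m : R) (u v w : R -> R).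

(** From [ln (1 + z) <= z] at [z = (y - x) / x]. *)
Lemma ln_dist m x y : 0 < m -> m <= x -> m <= y -> `|ln y - ln x| <= m^-1 * `|y - x|.
Proof.
move=> m0; wlog xy : x y / x <= y.
  move=> H mx my; have [xy|/ltW yx] := leP x y; first exact: H.
  by rewrite distrC (distrC y); exact: H.
move=> mx my; have x0 : 0 < x := lt_le_trans m0 mx; have y0 := lt_le_trans m0 my.
rewrite !ger0_norm ?subr_ge0 ?ler_ln//.
have <- : ln (y / x) = ln y - ln x by rewrite ln_div.
have -> : y / x = 1 + (y - x) / x by field; rewrite gt_eqF.
have yx0 : 0 <= (y - x) / x by rewrite divr_ge0 ?subr_ge0// ltW.
apply: le_trans (le_ln1Dx _) _; first by lra.
by rewrite mulrC ler_wpM2r ?subr_ge0// lef_pV2.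
Qed.

(** From [1 + z <= expR z] at [z = x - y]. *)
Lemma expR_dist x y (M : R) : x <= M -> y <= M ->
  `|expR y - expR x| <= expR M * `|y - x|.
Proof.
wlog xy : x y / x <= y.
  move=> H xM yM; have [xy|/ltW yx] := leP x y; first exact: H.
  by rewrite distrC (distrC y); exact: H.
move=> xM yM; rewrite !ger0_norm ?subr_ge0 ?ler_expR//.
apply: (@le_trans _ _ (expR y * (y - x))); last first.
  by rewrite ler_wpM2r ?subr_ge0 ?ler_expR.
have -> : expR x = expR y * expR (x - y) by rewrite -expRD; congr expR; ring.
rewrite -[X in X - _]mulr1 -mulrBr ler_wpM2l ?expR_ge0//.
by have := expR_ge1Dx (x - y); lra.
Qed.

Lemma abs_continuous_gt0_lb a b u : a <= b -> abs_continuous a b u ->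
  (forall x, a <= x <= b -> 0 < u x) ->
  exists2 m, 0 < m & forall x, a <= x <= b -> m <= u x.
Proof.
move=> ab acu u0; have cu := continuous_subspaceT (A := `[a, b]) (abs_continuous_clamp ab acu).
have [c cab mu] := EVT_min ab cu.
exists (u c); first by apply: u0; move: cab; rewrite in_itv.
move=> x xab; have := mu x; rewrite in_itv/= => /(_ xab).
by rewrite !clamp_id//; move: cab; rewrite in_itv.
Qed.

Lemma abs_continuous_ln a b u : a <= b -> abs_continuous a b u ->
  (forall x, a <= x <= b -> 0 < u x) -> abs_continuous a b (fun x => ln (u x)).
Proof.
move=> ab acu /(abs_continuous_gt0_lb ab acu)[m m0 um].
apply: (abs_continuous_dom acu acu (K := m^-1) (L := 0)) => x y ax xy yb.
rewrite mul0r addr0; apply: ln_dist => //; apply: um; apply/andP; split; lra.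
Qed.

Lemma abs_continuousB a b u v : abs_continuous a b u -> abs_continuous a b v ->
  abs_continuous a b (fun x => u x - v x).
Proof.
move=> acu acv; apply: (abs_continuous_dom acu acv (K := 1) (L := 1)) => x y _ _ _.
have -> : u y - v y - (u x - v x) = (u y - u x) - (v y - v x) by ring.
by rewrite !mul1r ler_normB.
Qed.

End Estimates.

Section UnitVariation.
Context {R : realType}.
Implicit Types (x y : R) (u v w : R -> R).

Definition unit_TV u : R := fine (total_variation 0 1 u).
Local Notation V := unit_TV.
Local Notation AC := (abs_continuous 0 1).

Lemma unit_TV_ge0 u : 0 <= V u.
Proof. exact: fine_TV_ge0. Qed.

Lemma unit_TV_dom u v w (K L : R) : AC u -> AC v -> 0 <= K -> 0 <= L ->
  (forall x y, 0 <= x -> x <= y -> y <= 1 ->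
     `|w y - w x| <= K * `|u y - u x| + L * `|v y - v x|) ->
  V w <= K * V u + L * V v.
Proof.
move=> acu acv K0 L0 H.
by have [] := TV_dom ler01 K0 L0 (abs_continuous_BV ler01 acu) (abs_continuous_BV ler01 acv) H.
Qed.

Lemma unit_TV_dist u x y : AC u -> 0 <= x <= 1 -> 0 <= y <= 1 -> `|u y - u x| <= V u.
Proof.
move=> acu; have bvu := abs_continuous_BV ler01 acu.
wlog xy : x y / x <= y.
  move=> H xI yI; have [xy|/ltW yx] := leP x y; first exact: H.
  by rewrite distrC; exact: H.
move=> /andP[x0 x1] /andP[y0 y1]; apply: le_trans (fine_TV_ge bvu x0 xy y1) _.
rewrite /V (fine_TVD bvu (lexx 0) y0 y1 (lexx 1)) (fine_TVD bvu (lexx 0) x0 xy y1).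
have := fine_TV_ge0 u x0; have := fine_TV_ge0 u y1; lra.
Qed.

(** The constant [c] makes room for the logarithm of a normalizing factor; [t = 0] says that
    constants have no variation. *)
Lemma unit_TV_scale u w (t c : R) : AC u -> 0 <= t ->
  (forall x, 0 <= x <= 1 -> w x = t * u x + c) -> V w <= t * V u.
Proof.
move=> acu t0 wE.
have := @unit_TV_dom u u w t 0 acu acu t0 (lexx 0); rewrite mul0r addr0; apply.
move=> x y x0 xy y1; rewrite !wE; [|by apply/andP; split; lra..].
have -> : t * u y + c - (t * u x + c) = t * (u y - u x) by ring.
by rewrite normrM ger0_norm// mul0r addr0.
Qed.

Lemma eq_unit_TV u w : AC u -> (forall x, 0 <= x <= 1 -> w x = u x) -> V w = V u.
Proof.
move=> acu wE; apply/eqP; rewrite eq_le; apply/andP; split.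
  rewrite -[leRHS]mul1r; apply: (unit_TV_scale (c := 0)) => // x xI.
  by rewrite wE//; ring.
rewrite -[leRHS]mul1r; apply: (unit_TV_scale (c := 0)) => // [|x xI].
  by apply: eq_abs_continuous acu => x xI; rewrite wE.
by rewrite wE//; ring.
Qed.

End UnitVariation.

Section UnitBall.
Context {R : realType} (G : PreTopologicalGroup.type).

(** Continuity at the single point [(1, 1)], where [s] vanishes, is enough. *)
Lemma pseudometric_unit_ball (rho s : G -> G -> R) :
  (forall U : set G, open U -> metric_open rho U) ->
  continuous_right_invariant_pseudometric s ->
  exists2 e, 0 < e & forall h, rho 1%g h < e -> s h 1%g < 1.
Proof.
move=> openE [[s0 sxx sC stri] scont _].
have /cvgrPdist_lt/(_ 1 ltr01)[[U W] /= [nU nW] UW] := scont (1%g, 1%g).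
move: nW; rewrite nbhsE => -[B [/openE oB B1] BW].
have [e e0 eB] := oB _ B1; exists e => // h /eB/BW Wh.
have := UW (1%g, h); rewrite /= sxx sub0r normrN sC => H.
by apply: (le_lt_trans (ler_norm _)); apply: H; split=> //=; exact: nbhs_singleton.
Qed.

End UnitBall.

Section AbstractMaximality.
Context {R : realType} (G : PreTopologicalGroup.type).
(** [D f] is the derivative, [S] the uniform distance between values, and [P] the subgroup of maps
    fixing the base point: the whole group for the interval, the stabilizer of the class of 0 for
    the circle. *)
Variables (D : G -> R -> R) (S rho d : G -> G -> R) (P : set G).
Local Notation I := (`[0%R, 1%R]%classic : set R).
Local Notation V := unit_TV.
Local Notation AC := (abs_continuous 0 1).
Local Notation L f := (fun x => ln (D f x)).

Hypothesis openE : forall U : set G, open U <-> metric_open rho U.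
Hypothesis D_gt0 : forall f x, 0 <= x <= 1 -> 0 < D f x.
Hypothesis D_ac : forall f, AC (D f).
Hypothesis S_ge0 : forall f g, 0 <= S f g.
Hypothesis rhoE : forall f g, rho f g =
  S f g + sup [set `|D f x - D g x| | x in I] + V (fun x => D f x - D g x).
Hypothesis dE : forall f g, d f g = V (fun x => ln (D f x) - ln (D g x)).
Hypothesis d_right : right_invariant d.
Hypothesis D1 : forall x, 0 <= x <= 1 -> D 1%g x = 1.
Hypothesis P_div : forall f g, P f -> P g -> P (f * g^-1)%g.
Hypothesis P_mean : forall f, P f -> exists2 c, 0 <= c <= 1 & D f c = 1.
Hypothesis P_inj : forall h, P h -> (forall x, 0 <= x <= 1 -> D h x = 1) -> h = 1%g.
Hypothesis P_chain : forall f (t : R), P f -> 0 <= t <= 1 -> exists g c,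
  P g /\ forall x, 0 <= x <= 1 -> ln (D g x) = t * ln (D f x) + c.
Hypothesis P_S : forall h (e : R), P h ->
  (forall x, 0 <= x <= 1 -> `|D h x - 1| <= e) -> S 1%g h <= e.

Let L_ac f : AC (L f).
Proof. exact: (abs_continuous_ln ler01 (D_ac f) (@D_gt0 f)). Qed.

Let LB_ac f g : AC (fun x => L f x - L g x).
Proof. exact: (abs_continuousB (L_ac f) (L_ac g)). Qed.

Let d_pseudometric : is_pseudometric d.
Proof.
split=> [f g|f|f g|f g h].
- by rewrite dE unit_TV_ge0.
- rewrite dE; apply/eqP; rewrite eq_le unit_TV_ge0 andbT -[leRHS](mul0r (V (L f))).
  by apply: (unit_TV_scale (c := 0)) => // x _; ring.
- have H f' g' : d f' g' <= d g' f'.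
    rewrite !dE -[leRHS]mul1r -[leRHS]addr0 -(mul0r (V (L f))).
    apply: unit_TV_dom => // x y _ _ _.
    rewrite mul0r addr0 mul1r -normrN le_eqVlt; apply/orP; left.
    by apply/eqP; congr `|_|; ring.
  by apply/eqP; rewrite eq_le !H.
- rewrite !dE.
  have := unit_TV_dom (w := fun x => ln (D f x) - ln (D h x)) (LB_ac f g) (LB_ac g h) ler01 ler01.
  rewrite !mul1r; apply => x y _ _ _; rewrite !mul1r.
  apply: le_trans (ler_normD _ _); rewrite le_eqVlt; apply/orP; left.
  by apply/eqP; congr `|_|; ring.
Qed.

(** A set must be bounded above for [sup] to bound it; the bound is the value at 0 plus the
    variation. *)
Let supD f g x : 0 <= x <= 1 ->
  `|D f x - D g x| <= sup [set `|D f x - D g x| | x in I].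
Proof.
move=> xI; apply: ub_le_sup; last by exists x => //=; rewrite in_itv.
exists (`|D f 0 - D g 0| + V (fun x => D f x - D g x)) => _ [y /= + <-].
rewrite in_itv/= => yI.
have I0 : 0 <= (0 : R) <= 1 by rewrite lexx ler01.
have := @unit_TV_dist R (fun x => D f x - D g x) 0 y (abs_continuousB (D_ac f) (D_ac g)) I0 yI.
set p := D f y - D g y; set q := D f 0 - D g 0 => pq.
by have := ler_normD (p - q) q; rewrite subrK; lra.
Qed.

(** The difference of the logarithms is [- ln w] with [w = D h / D g]. Uniform closeness keeps [w]
    above 1/2, where [ln] is 2-Lipschitz, so it remains to bound the increments of [w]. *)
Let d_rho g (e : R) : 0 < e -> exists2 t, 0 < t & forall h, rho g h < t -> d g h < e.
Proof.
move=> e0.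
have [m m0 gm] := abs_continuous_gt0_lb ler01 (D_ac g) (@D_gt0 g).
(* Collects the factors of [s] and [v] in the bound [H] below; [m] is a lower bound of [D g]. *)
pose C := 2 * m^-1 * m^-1 * V (D g) + 2 * m^-1.
have im0 : 0 < m^-1 by rewrite invr_gt0.
have C0 : 0 < C.
  by rewrite ltr_wpDl// ?mulr_gt0// !mulr_ge0 ?unit_TV_ge0// ltW.
exists (Num.min (m / 2) (e / C)); first by rewrite lt_min !divr_gt0.
move=> h; rewrite lt_min rhoE; set s := sup _; set v := V _.
have v0 : 0 <= v by exact: unit_TV_ge0.
have s0 : 0 <= s.
  by apply: le_trans (normr_ge0 _) (@supD g h 0 _); rewrite lexx ler01.
have S0 := S_ge0 g h; move=> /andP[rm re].
have sm : s < m / 2 by lra.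
have hm x : 0 <= x <= 1 -> m / 2 <= D h x.
  move=> xI; have := gm x xI; have := supD g h xI; rewrite -/s.
  by have := ler_norm (D g x - D h x); lra.
have mE : m * m^-1 = 1 by rewrite divff// gt_eqF.
pose k x := D g x - D h x.
have kac : AC k by exact: abs_continuousB.
have H : d g h <= 2 * m^-1 * m^-1 * s * V (D g) + 2 * m^-1 * v.
  rewrite dE /v; apply: (@unit_TV_dom _ (D g) k); [exact: D_ac|exact: kac| | |].
    by rewrite !mulr_ge0// ltW.
    by rewrite mulr_ge0// ltW.
  move=> x y x0 xy y1.
  have xI : 0 <= x <= 1 by apply/andP; split; lra.
  have yI : 0 <= y <= 1 by apply/andP; split; lra.
  have gx := gm x xI; have gy := gm y yI.
  have gx0 := lt_le_trans m0 gx; have gy0 := lt_le_trans m0 gy.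
  have hx0 := D_gt0 h xI; have hy0 := D_gt0 h yI.
  pose w z := D h z / D g z.
  have wE z : 0 <= z <= 1 -> 2^-1 <= w z.
    move=> zI; rewrite /w ler_pdivlMr; last exact: D_gt0.
    have := gm z zI; have := supD g h zI; rewrite -/s.
    by have := ler_norm (D g z - D h z); lra.
  have lnE z : 0 <= z <= 1 -> ln (D g z) - ln (D h z) = - ln (w z).
    by move=> zI; rewrite /w ln_div ?opprB// posrE D_gt0.
  rewrite !lnE//; have -> : - ln (w y) - - ln (w x) = - (ln (w y) - ln (w x)) by ring.
  rewrite normrN.
  have i20 : (0 : R) < 2^-1 by [].
  apply: (le_trans (ln_dist i20 (wE x xI) (wE y yI))); rewrite invrK.
  (* Here [w = 1 - k / D g], and this is the difference form of the quotient rule. *)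
  have -> : w y - w x = k y * (D g y - D g x) / (D g x * D g y) - (k y - k x) / D g x.
    by rewrite /w /k; field; rewrite !gt_eqF.
  have ix : (D g x)^-1 <= m^-1 by rewrite lef_pV2.
  have iy : (D g y)^-1 <= m^-1 by rewrite lef_pV2.
  have ix0 : 0 < (D g x)^-1 by rewrite invr_gt0.
  have iy0 : 0 < (D g y)^-1 by rewrite invr_gt0.
  have A1 : `|k y * (D g y - D g x) / (D g x * D g y)| <= m^-1 * m^-1 * s * `|D g y - D g x|.
    rewrite !normrM invfM normrM (gtr0_norm ix0) (gtr0_norm iy0).
    rewrite mulrC mulrA ler_wpM2r//; apply: ler_pM => //; last exact: supD.
      by rewrite mulr_ge0// ltW.
    by apply: ler_pM => //; exact: ltW.
  have A2 : `|(k y - k x) / D g x| <= m^-1 * `|k y - k x|.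
    by rewrite normrM (gtr0_norm ix0) mulrC ler_wpM2r.
  apply: (@le_trans _ _ (2 * (m^-1 * m^-1 * s * `|D g y - D g x| + m^-1 * `|k y - k x|))).
    by rewrite ler_wpM2l//; apply: le_trans (ler_normB _ _) (lerD A1 A2).
  by rewrite le_eqVlt; apply/orP; left; apply/eqP; ring.
apply: (le_lt_trans H).
have : (s + v) * C < e by rewrite -ltr_pdivlMr//; lra.
apply: le_lt_trans.
have -> : (s + v) * C = 2 * m^-1 * m^-1 * s * V (D g) + 2 * m^-1 * v +
    (2 * m^-1 * m^-1 * V (D g) * v + 2 * m^-1 * s) by rewrite /C; ring.
rewrite lerDl addr_ge0// !mulr_ge0// ?unit_TV_ge0// ltW//.
Qed.

(** Since [ln (D h)] vanishes at some [c], it is bounded everywhere by its variation [d h 1];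
    exponentiating costs a Lipschitz constant only. *)
Let rho_d (e : R) : 0 < e -> exists2 t, 0 < t & forall h, P h -> d h 1%g < t -> rho 1%g h < e.
Proof.
move=> e0; pose E : R := expR 1; have E0 : 0 < E := expR_gt0 1.
(* The bound 1 keeps the logarithms in the range where [expR] is [E]-Lipschitz; each of the three
   terms of [rho] is then at most [E * d h 1]. *)
exists (Num.min 1 (e / (4 * E))); first by rewrite lt_min ltr01 divr_gt0// mulr_gt0.
move=> h Ph; rewrite lt_min ltr_pdivlMr ?mulr_gt0// => /andP[d1 dE4].
have dV : d h 1%g = V (L h).
  by rewrite dE; apply: eq_unit_TV => // x xI; rewrite D1// ln1 subr0.
have [c cI hc] := P_mean Ph.
have Lh x : 0 <= x <= 1 -> `|ln (D h x)| <= d h 1%g.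
  move=> xI; have := unit_TV_dist (L_ac h) cI xI; rewrite -dV hc ln1 subr0.
  by [].
have Lh1 x : 0 <= x <= 1 -> ln (D h x) <= 1.
  by move=> xI; have := Lh x xI; have := ler_norm (ln (D h x)); lra.
have DE x : 0 <= x <= 1 -> D h x = expR (ln (D h x)).
  by move=> xI; rewrite lnK// posrE D_gt0.
have H1 x : 0 <= x <= 1 -> `|D h x - 1| <= E * d h 1%g.
  move=> xI; rewrite DE// -expR0.
  apply: le_trans (expR_dist (M := 1) _ (Lh1 x xI)) _ => //.
  by rewrite subr0 ler_wpM2l ?(ltW E0)// Lh.
have H2 : S 1%g h <= E * d h 1%g by exact: P_S.
have H3 : sup [set `|D 1%g x - D h x| | x in I] <= E * d h 1%g.
  apply: ge_sup; first by exists `|D 1%g 0 - D h 0|; exists 0 => //=; rewrite in_itv/= lexx ler01.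
  move=> _ [x /= + <-]; rewrite in_itv/= => xI.
  by rewrite D1// distrC H1.
have H4 : V (fun x => D 1%g x - D h x) <= E * d h 1%g.
  rewrite dV -[leRHS]addr0 -(mul0r (V (L h))).
  apply: unit_TV_dom => //; first exact: ltW.
  move=> x y x0 xy y1; rewrite mul0r addr0.
  have xI : 0 <= x <= 1 by apply/andP; split; lra.
  have yI : 0 <= y <= 1 by apply/andP; split; lra.
  rewrite !D1//; have -> : 1 - D h y - (1 - D h x) = - (D h y - D h x) by ring.
  by rewrite normrN (DE y)// (DE x)// !expRK; apply: expR_dist; rewrite Lh1.
rewrite rhoE; have := unit_TV_ge0 (L h); rewrite -dV; lra.
Qed.

(** By the triangle inequality, [d_rho] at each [g] of the ball gives a [rho]-ball around [g] inside
    it. *)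
Let d_ball f (e : R) : 0 < e -> nbhs f [set g | d f g < e].
Proof.
have [d0 dxx _ dtri] := d_pseudometric.
move=> e0; rewrite nbhsE/=; exists [set g | d f g < e] => //; split; last by rewrite /= dxx.
apply/openE => g /= fg.
have eg : 0 < e - d f g by lra.
have [t t0 th] := d_rho g eg; exists t => // h /th gh.
by have := dtri f g h; lra.
Qed.

Let d_continuous : continuous (fun p : G * G => d p.1 p.2).
Proof.
have [d0 dxx dC dtri] := d_pseudometric.
move=> [f g]; apply/cvgrPdist_lt => e e0 /=.
have e2 : 0 < e / 2 by rewrite divr_gt0.
exists ([set h | d f h < e / 2], [set h | d g h < e / 2]).
  by split; exact: d_ball.
move=> [f' g'] /= [ff' gg'].
have := dtri f f' g; have := dtri f' g' g; have := dtri f' f g'; have := dtri f g g'.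
by rewrite (dC g' g) (dC f' f) ltr_norml => *; apply/andP; split; lra.
Qed.

(** The premise replaces any [f] by an element of [P] equally far from 1 for [d], at a bounded cost
    for [s]; on [P] the chain applies. *)
Lemma maximal_pseudometric_of_chain :
  (forall s : G -> G -> R, continuous_right_invariant_pseudometric s ->
    exists C, forall f, exists f1, [/\ P f1, d f1 1%g = d f 1%g & s f 1%g <= s f1 1%g + C]) ->
  maximal_pseudometric d.
Proof.
move=> red; split; first by split.
move=> s cs; have [C sC] := red s cs.
have [[s0 sxx _ stri] _ sright] := cs.
have [e e0 se] := pseudometric_unit_ball (fun U => (openE U).1) cs.
have [t t0 dt] := rho_d e0.
have step h : P h -> d h 1%g < t -> s h 1%g < 1 by move=> Ph /(dt _ Ph)/se.
have key f (N : nat) : P f -> (0 < N)%N -> d f 1%g < t * N%:R -> s f 1%g <= N%:R.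
  move=> Pf N0 dN.
  have NR : 0 < N%:R :> R by rewrite ltr0n.
  have dV : d f 1%g = V (L f).
    by rewrite dE; apply: eq_unit_TV => // x xI; rewrite D1// ln1 subr0.
  have /choice[g gP] : forall k : nat, exists g, (k <= N)%N -> exists c : R,
      P g /\ forall x, 0 <= x <= 1 -> ln (D g x) = k%:R / N%:R * ln (D f x) + c.
    move=> k; have [kN|kN] := leqP k N; last by exists 1%g.
    have [|g [c gc]] := @P_chain f (k%:R / N%:R) Pf; last by exists g => _; exists c.
    by rewrite divr_ge0//= ler_pdivrMr// mul1r ler_nat.
  (* Elements of [P] whose log-derivatives differ by a constant coincide: their quotient has
     constant log-derivative, which vanishes somewhere. This identifies both ends of the chain. *)
  have eq1 g1 f1 (c : R) : P g1 -> P f1 ->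
      (forall x, 0 <= x <= 1 -> ln (D g1 x) = ln (D f1 x) + c) -> g1 = f1.
    move=> Pg Pf1 gf; have Ph := P_div Pg Pf1.
    have dh : V (L (g1 * f1^-1)%g) = 0.
      apply/eqP; rewrite eq_le unit_TV_ge0 andbT.
      have -> : V (L (g1 * f1^-1)%g) = d (g1 * f1^-1)%g 1%g.
        by rewrite dE; apply/esym/eq_unit_TV => // x xI; rewrite D1// ln1 subr0.
      rewrite -(mulgV f1) d_right dE -[leRHS](mul0r (V (L f1))).
      apply: (unit_TV_scale (c := c)) => // x xI; rewrite gf//; ring.
    have [c' c'I hc] := P_mean Ph.
    have h1 : (g1 * f1^-1)%g = 1%g.
      apply: P_inj => // x xI; have := unit_TV_dist (L_ac (g1 * f1^-1)%g) c'I xI.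
      rewrite dh hc ln1 subr0 normr_le0 => /eqP l0.
      by rewrite -[LHS]lnK ?posrE ?D_gt0// l0 expR0.
    by rewrite -[g1](mulgVK f1) h1 mul1g.
  have H k : (k <= N)%N -> s (g k) 1%g <= k%:R.
    elim: k => [|k IH] kN.
      have [c [Pg gE]] := gP 0%N kN.
      have P1 : P 1%g by rewrite -(mulgV f); exact: P_div.
      rewrite (@eq1 (g 0%N) 1%g c) ?sxx// => x xI.
      by rewrite gE// D1// ln1; ring.
    have [c [Pg gE]] := gP _ kN; have [c' [Pg' gE']] := gP _ (ltnW kN).
    have : s (g k.+1) (g k) < 1.
      (* Right invariance moves the step to the identity, where its [d]-length is [V (L f) / N],
         below [t]. *)
      rewrite -[g k.+1](mulgVK (g k)) -[X in s _ X]mul1g sright; apply: step.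
        exact: P_div.
      rewrite -(mulgV (g k)) d_right; apply: (@le_lt_trans _ _ (N%:R^-1 * V (L f))).
        rewrite dE; apply: (unit_TV_scale (c := c - c')) => // x xI.
        by rewrite gE// gE'// -[k.+1%:R]natr1; ring.
      by rewrite -dV mulrC ltr_pdivrMr.
    by have := stri (g k.+1) (g k) 1%g; have := IH (ltnW kN); rewrite -[k.+1%:R]natr1; lra.
  have [c [Pg gE]] := gP N (leqnn N).
  rewrite -(@eq1 (g N) f c) ?H// => x xI.
  by rewrite gE// divff ?gt_eqF// mul1r.
exists t^-1, (1 + C) => f g.
have -> : s f g = s (f * g^-1)%g 1%g by rewrite -(mulgV g) sright.
have -> : d f g = d (f * g^-1)%g 1%g by rewrite -(mulgV g) d_right.
have [h [Ph <- sh]] := sC (f * g^-1)%g.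
have [d0 _ _ _] := d_pseudometric.
have q0 : 0 <= d h 1%g / t by rewrite divr_ge0// ltW.
have /andP[tl tr] := truncn_itv q0.
(* The number of steps is the least integer above [d h 1 / t], hence at most [d h 1 / t + 1]. *)
have := key h (Num.truncn (d h 1%g / t)).+1 Ph isT.
rewrite mulrC -ltr_pdivrMr// => /(_ tr); rewrite -natr1 (mulrC t^-1).
lra.
Qed.

End AbstractMaximality.

(** * Primitives and reparametrizations *)

Section Primitive.
Context {R : realType}.
Implicit Types (x y : R) (w F G : R -> R).
Local Notation leb := (@lebesgue_measure R).

Lemma C1_is_derive F x : C1 F -> is_derive x 1 F (F^`()%classic x).
Proof. by move=> [dF _]; rewrite derive1E; apply: DeriveDef. Qed.

Lemma C1_MVT F x y : C1 F -> x <= y ->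
  exists2 c, x <= c <= y & F y - F x = F^`()%classic c * (y - x).
Proof.
move=> CF xy; have [||c + ->] := @MVT_segment R F F^`()%classic x y xy.
- by move=> z _; exact: C1_is_derive.
- by apply: continuous_subspaceT; exact: C1_continuous.
by rewrite in_itv/= => cI; exists c.
Qed.

Lemma is_derive_C1 F w : (forall x, is_derive x 1 F (w x)) -> continuous w ->
  C1 F /\ F^`()%classic = w.
Proof.
move=> dF cw; have Fw : F^`()%classic = w.
  by apply/funext => x; rewrite derive1E; have [_ ->] := dF x.
by split=> //; split; [move=> x; have [] := dF x|rewrite Fw].
Qed.

Lemma continuous_primitive w : continuous w ->
  exists F, F 0 = 0 /\ forall x, is_derive x 1 F (w x).
Proof.
(* At least one of the two integrals is over an empty interval: their difference is the signed
   integral from 0 to [x]. *)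
move=> cw; exists (fun x => \int[leb]_(t in `]0, x]) w t - \int[leb]_(t in `]x, 0]) w t).
split; first by rewrite subrr.
(* Integrating from [N], to the left of both 0 and [x], avoids a change of sign at 0. *)
move=> x; set F := fun x => _; pose N := - (`|x| + 1).
have iw y : leb.-integrable `]N, y] (EFin \o w).
  apply: (@integrableS _ _ _ leb `[N, y]) => //.
    by apply: subset_itvr; rewrite bnd_simp.
  apply: continuous_compact_integrable; first exact: segment_compact.
  exact: continuous_subspaceT.
have N0 : N < 0 by rewrite /N; have := normr_ge0 x; lra.
have Nx : N < x by rewrite /N; have := ler_norm (- x); rewrite normrN; lra.
pose H y := \int[leb]_(t in [set` Interval (BRight N) (BRight y)]) w t.
have HF y : N < y -> H y - H 0 = F y.
  move=> Ny; rewrite /F; have [y0|y0] := leP 0 y.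
    rewrite /H Rintegral_itvB ?bnd_simp//; [|exact: ltW].
    by rewrite [X in _ - X](_ : _ = 0) ?subr0// set_itv_ge ?Rintegral_set0// bnd_simp -leNgt.
  rewrite -opprB /H Rintegral_itvB ?bnd_simp//; [|exact: ltW|exact: ltW].
  by rewrite [in RHS]set_itv_ge ?Rintegral_set0 ?sub0r// bnd_simp -leNgt ltW.
have xx1 : x < x + 1 by rewrite ltrDl.
have [dH HE] : derivable H x 1 /\ H^`()%classic x = w x.
  by apply: (continuous_FTC1 xx1 (iw _)) => //; exact: cw.
have near_F : \forall y \near x, H y - H 0 = F y.
  by apply: filterS (lt_nbhsr Nx) => y; exact: HF.
apply: (near_eq_is_derive near_F).
rewrite -[w x]subr0 -HE derive1E; apply: is_deriveB; first exact: DeriveDef.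
Qed.

(** A weight bounded below by [m > 0] makes the primitive grow at least linearly, hence onto the
    line with a C^1 inverse; [c] rescales its value at 1 to 1. *)
Lemma normalized_primitive w (m : R) : continuous w -> 0 < m -> (forall x, m <= w x) ->
  exists F G c, [/\ 0 < c, F 0 = 0, F 1 = 1,
    [/\ cancel F G, cancel G F & {homo F : x y / x < y}] &
    [/\ C1 F, C1 G & F^`()%classic = (fun x => c * w x)]].
Proof.
move=> cw m0 wm; have [F0 [F00 dF0]] := continuous_primitive cw.
have [CF0 F0E] := is_derive_C1 dF0 cw.
have F0_ge x y : x <= y -> m * (y - x) <= F0 y - F0 x.
  move=> xy; have [c _ ->] := C1_MVT CF0 xy; rewrite F0E.
  by apply: ler_wpM2r => //; rewrite subr_ge0.
have F01 : 0 < F0 1.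
  by have := F0_ge 0 1 ler01; rewrite F00; lra.
pose c := (F0 1)^-1; have c0 : 0 < c by rewrite invr_gt0.
pose F x := c * F0 x.
have dF x : is_derive x 1 F (c * w x) by exact: is_deriveZ.
have cw' : continuous (fun x => c * w x).
  by move=> x; apply: cvgM; [exact: cvg_cst|exact: cw].
have [CF FE] := is_derive_C1 dF cw'.
have F_ge x y : x <= y -> c * m * (y - x) <= F y - F x.
  by move=> xy; rewrite /F -mulrBr -mulrA ler_pM2l// F0_ge.
have cm0 : 0 < c * m by rewrite mulr_gt0.
have F0' : F 0 = 0 by rewrite /F F00 mulr0.
have Finc : {homo F : x y / x < y}.
  move=> x y xy; rewrite -subr_gt0; apply: lt_le_trans (F_ge x y (ltW xy)).
  by rewrite mulr_gt0// subr_gt0.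
have Fsurj y : exists x, F x = y.
  (* All slopes of [F] are at least [c * m], so [F] takes the value [y] between [- k] and [k] with
     [k] the quotient of [|y|] by [c * m]. *)
  have yk : `|y| = c * m * (`|y| / (c * m)) by field; rewrite !gt_eqF.
  set k := `|y| / (c * m) in yk; have k0 : 0 <= k by rewrite divr_ge0// ltW.
  have cF : {within `[- k, k], continuous F}.
    by apply: continuous_subspaceT; exact: C1_continuous.
  have [||x _ <-] := @IVT _ F (- k) k y _ cF; last by exists x.
    by lra.
  have := F_ge 0 k k0; have := F_ge (- k) 0; rewrite F0' subr0 sub0r opprK -yk oppr_le0.
  move=> /(_ k0) H1 H2; have := ler_norm y; have := ler_norm (- y); rewrite normrN => *.
  by rewrite ge_min le_max; apply/andP; split; apply/orP; [left|right]; lra.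
have /choice[G FK] := Fsurj.
have Finj : injective F.
  move=> x y Fxy; apply/eqP; rewrite eq_le !leNgt; apply/andP; split;
    by apply/negP => /Finc; rewrite Fxy ltxx.
have GK : cancel F G by move=> x; apply: Finj; rewrite FK.
have dG y : is_derive y 1 G (c * w (G y))^-1.
  rewrite -{1}[y]FK; apply: is_derive_inverse => //.
  - by near=> x; exact: GK.
  - by near=> x; exact: C1_continuous.
  - by rewrite mulf_neq0 ?gt_eqF//; exact: lt_le_trans (wm _).
have cG : continuous G.
  move=> x; apply/differentiable_continuous/derivable1_diffP.
  by have [] := dG x.
have [CG GE] : C1 G /\ G^`()%classic = fun y => (c * w (G y))^-1.
  apply: is_derive_C1 => // y; apply: cvgV.
    by rewrite mulf_neq0 ?gt_eqF//; exact: lt_le_trans (wm _).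
  by apply: cvgM; [exact: cvg_cst|apply: continuous_comp; [exact: cG|exact: cw]].
exists F, G, c; split=> //; first by rewrite /F /c mulVf// gt_eqF.
Unshelve. all: by end_near. Qed.

End Primitive.

(** * Variation under reparametrization *)

Section VariationComp.
Context {R : realType}.
Implicit Types (a b x y : R) (u v h f g : R -> R).
Local Notation leb := (@lebesgue_measure R).

(** An increasing [h] carries partitions to partitions with the same sums. *)
Lemma TV_comp_le a b u h : a < b ->
  (forall x y, a <= x -> x < y -> y <= b -> h x < h y) ->
  (total_variation a b (u \o h) <= total_variation (h a) (h b) u)%E.
Proof.
move=> ab hinc; apply: ge_ereal_sup => _ [_ [s abs <-] <-].
apply: ereal_sup_ubound; exists (variation a b (u \o h) s) => //.
exists (map h s).
  have [as_ /eqP sb] := abs; split; last by rewrite last_map sb.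
  rewrite path_map.
  have sI x : x \in a :: s -> a <= x <= b.
    move=> xs; rewrite -(nth_index b xs); apply: (itv_partition_node_itv abs).
    by rewrite -ltnS -[X in (_ < X)%N]/(size (a :: s)) index_mem.
  (* [h] is increasing only on [[a, b]], so the bounds are carried along the path. *)
  have as' : path (fun x y => [&& x < y, a <= x & y <= b]) a s.
    apply: (sub_in_path _ _ as_ (P := [pred x | a <= x <= b])) => [x y /= /andP[ax xb] /andP[ay yb] xy|].
      by rewrite xy ax yb.
    by apply/allP => x /sI.
  by apply: sub_path as' => x y /and3P[xy ax yb]; exact: hinc.
rewrite /variation/= size_map !big_nat; apply: eq_bigr => i /andP[_ si].
have E j : (j <= size s)%N -> nth (h b) (h a :: map h s) j = h (nth b (a :: s) j).
  by move=> js; rewrite -[h a :: map h s]/(map h (a :: s)) (nth_map b).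
by have := E i.+1 si; have := E i (ltnW si) => /= -> ->.
Qed.

(** Cut [[a, a + 1]] at 1 and [[0, 1]] at [a]; the pieces [[1, a + 1]] and [[0, a]] are translates
    of each other. *)
Lemma TV_periodic a u : (forall x, u (x + 1) = u x) ->
  0 <= a < 1 -> total_variation a (a + 1) u = total_variation 0 1 u.
Proof.
move=> u1 /andP[a0 a1].
rewrite (@total_variationD _ a (a + 1) 1); [|lra..].
rewrite (@total_variationD _ 0 1 a); [|lra..].
rewrite addeC; congr (_ + _)%E.
move: a0; rewrite le_eqVlt => /predU1P[<-|a0]; first by rewrite add0r !total_variationxx.
apply/eqP; rewrite eq_le; apply/andP; split.
  have := @TV_comp_le 1 (a + 1) u (fun x => x - 1).
  have -> : u \o (fun x => x - 1) = u by apply/funext => x /=; rewrite -u1 subrK.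
  by rewrite subrr addrK; apply; [lra|move=> *; lra].
have := @TV_comp_le 0 a u (fun x => x + 1) a0.
have -> : u \o (fun x => x + 1) = u by apply/funext => x /=; rewrite u1.
by rewrite add0r; apply => *; lra.
Qed.

Lemma derive1_ln_sub f g x : derivable f x 1 -> derivable g x 1 -> 0 < f x -> 0 < g x ->
  (fun x => ln (f x) - ln (g x))^`()%classic x = f^`()%classic x / f x - g^`()%classic x / g x.
Proof.
move=> df dg f0 g0.
have Df : is_derive x 1 f (f^`()%classic x) by rewrite derive1E; apply: DeriveDef.
have Dg : is_derive x 1 g (g^`()%classic x) by rewrite derive1E; apply: DeriveDef.
have Dlf := is_derive1_comp (is_derive1_ln f0) Df.
have Dlg := is_derive1_comp (is_derive1_ln g0) Dg.
rewrite derive1E; have [_ ->] := is_deriveB Dlf Dlg.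
by rewrite !(mulrC _^-1).
Qed.

(** [f'] and [g'] are free where no derivative exists, which lets iterated [derive_I] and the
    ordinary derivative share one statement. *)
Lemma integral_dist_unit_TV f g (f' g' : R -> R) :
  abs_continuous 0 1 f -> abs_continuous 0 1 g ->
  (forall x, 0 < x < 1 -> derivable f x 1 -> f' x = f^`()%classic x) ->
  (forall x, 0 < x < 1 -> derivable g x 1 -> g' x = g^`()%classic x) ->
  \int[leb]_(x in `[0, 1]) `|f' x - g' x| = unit_TV (fun x => f x - g x).
Proof.
move=> acf acg fE gE; apply: TV_integral => //; first exact: abs_continuousB.
apply: filterS2 (abs_continuous_ae_derivable ler01 acf) (abs_continuous_ae_derivable ler01 acg).
  exact: (ae_filter_ringOfSetsType leb).
move=> x df dg xI _; rewrite fE ?gE//; [|exact: dg|exact: df].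
by rewrite !derive1E deriveB//; [exact: df|exact: dg].
Qed.

Lemma integral_log_dist_unit_TV f g (f' g' : R -> R) :
  abs_continuous 0 1 f -> abs_continuous 0 1 g ->
  (forall x, 0 <= x <= 1 -> 0 < f x) -> (forall x, 0 <= x <= 1 -> 0 < g x) ->
  (forall x, 0 < x < 1 -> derivable f x 1 -> f' x = f^`()%classic x) ->
  (forall x, 0 < x < 1 -> derivable g x 1 -> g' x = g^`()%classic x) ->
  \int[leb]_(x in `[0, 1]) `|f' x / f x - g' x / g x| =
  unit_TV (fun x => ln (f x) - ln (g x)).
Proof.
move=> acf acg f0 g0 fE gE; apply: TV_integral => //.
  by apply: abs_continuousB; exact: abs_continuous_ln.
apply: filterS2 (abs_continuous_ae_derivable ler01 acf) (abs_continuous_ae_derivable ler01 acg).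
  exact: (ae_filter_ringOfSetsType leb).
move=> x df dg xI _; have xI' : 0 <= x <= 1 by case/andP: xI => /ltW-> /ltW->.
rewrite fE ?gE//; [|exact: dg|exact: df].
by rewrite derive1_ln_sub//; [exact: df|exact: dg|exact: f0|exact: g0].
Qed.

End VariationComp.

(** * The interval *)

Section IntervalCalculus.
Context {R : realType}.
Implicit Types (f g h : diff_I R) (x y : R).
Local Notation I := (`[0%R, 1%R]%classic : set R).
Local Notation leb := (@lebesgue_measure R).

Lemma slope_fun_derive1 (u : R -> R) x : derivable u x 1 ->
  slope_fun u x @ within I x^' --> u^`()%classic x.
Proof.
move=> du.
have H : slope_fun u x @ x^' --> u^`()%classic x.
  rewrite derive1E; move: du => /cvg_ex[l ul].
  have -> : 'D_1 u x = l by apply/cvg_lim.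
  have sh : (fun y => y - x) @ x^' --> (0 : R)^'.
    move=> A [e /= e0 eA]; exists e => //= y xy yx; apply: eA.
      by rewrite /= sub0r normrN distrC.
    by rewrite /= subr_eq0.
  have := cvg_comp _ _ sh ul; apply: cvg_trans; apply: near_eq_cvg.
  near=> y; rewrite /= /slope_fun /GRing.scale/= mulr1 subrK mulrC.
  by [].
by apply: cvg_trans H => A; rewrite /nbhs/=; apply: filterS => y Ay _; exact: Ay.
Unshelve. all: by end_near. Qed.

Lemma derive_I_derive1 (u : R -> R) x : 0 < x < 1 -> derivable u x 1 ->
  derive_I u x = u^`()%classic x.
Proof.
move=> /andP[x0 x1] du; apply: derive_IE; first by rewrite /= in_itv/= !ltW.
exact: slope_fun_derive1.
Qed.

Lemma diff_I_itv f x : 0 <= x <= 1 -> 0 <= f x <= 1.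
Proof. by have := @is_diff_I_stable _ f x (diff_I_prop f); rewrite /= !in_itv. Qed.

Lemma diff_I_lt f x y : 0 <= x -> x < y -> y <= 1 -> f x < f y.
Proof.
move=> x0 xy y1; have [_ inc _ _ _] := diff_I_prop f.
by apply: inc => //; rewrite inE/= in_itv/=; apply/andP; split; lra.
Qed.

Lemma diff_I_le f x y : 0 <= x -> x <= y -> y <= 1 -> f x <= f y.
Proof.
move=> x0; rewrite le_eqVlt => /predU1P[->//|xy] y1.
by apply/ltW/diff_I_lt.
Qed.

Lemma diff_I0 f : f 0 = 0.
Proof.
have [g [fK gK]] := diff_I_inverse f.
have I0 : 0 <= (0 : R) <= 1 by rewrite lexx ler01.
have /andP[f0 _] := diff_I_itv f I0; have /andP[g0 g1] := diff_I_itv g I0.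
by apply/eqP; rewrite eq_le f0 andbT -[leRHS]gK diff_I_le.
Qed.

Lemma diff_I1 f : f 1 = 1.
Proof.
have [g [fK gK]] := diff_I_inverse f.
have I1 : 0 <= (1 : R) <= 1 by rewrite lexx ler01.
have /andP[_ f1] := diff_I_itv f I1; have /andP[g0 g1] := diff_I_itv g I1.
by apply/eqP; rewrite eq_le f1 -[leLHS]gK diff_I_le.
Qed.

Lemma diff_I_C1 f : C1_I f.
Proof. by have [] := diff_I_prop f. Qed.

Lemma diff_I_ac f : abs_continuous 0 1 (derive_I f).
Proof. by have [] := diff_I_prop f. Qed.

Lemma derive_I_chain f h x : 0 <= x <= 1 ->
  derive_I (f \o h) x = derive_I f (h x) * derive_I h x.
Proof.
move=> xI; apply: derive_I_comp; last by rewrite /= in_itv.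
- by move=> y z _ _; apply: is_diff_I_inj; exact: diff_I_prop.
- by move=> y; apply: is_diff_I_stable; exact: diff_I_prop.
- exact: diff_I_C1.
- exact: diff_I_C1.
Qed.

(** Nonnegative as a limit of slopes, and nonzero because the chain rule for the inverse makes it a
    factor of 1. *)
Lemma derive_I_gt0 f x : 0 <= x <= 1 -> 0 < derive_I f x.
Proof.
move=> xI; have [g [fK gK]] := diff_I_inverse f.
have Ix : I x by rewrite /= in_itv.
have gf1 : derive_I g (f x) * derive_I f x = 1.
  rewrite -derive_I_chain//; have -> : g \o f = id by apply/funext => y /=; rewrite fK.
  exact: derive_I_id.
rewrite lt_neqAle; apply/andP; split.
  by apply/eqP => f0; move: gf1; rewrite -f0 mulr0 => /eqP; rewrite eq_sym oner_eq0.
have PF := Defs.within_I_proper Ix.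
have fx := C1_I_cvg (diff_I_C1 f) Ix.
rewrite -(cvg_lim _ fx)//; apply: limr_ge; first by apply/cvg_ex; exists (derive_I f x).
suff H : \forall y \near x, y != x -> I y -> 0 <= slope_fun f x y by exact: H.
exists 1 => //= y _ yx; rewrite in_itv/= => /andP[y0 y1]; move/andP: xI => [x0 x1].
rewrite /slope_fun; have [xy|yx'] := leP x y.
  by rewrite divr_ge0 ?subr_ge0// diff_I_le.
by rewrite -mulrNN -invrN !opprB divr_ge0 ?subr_ge0 ?(ltW yx')// diff_I_le// ltW.
Qed.

Lemma diff_I_MVT f x y : 0 <= x -> x <= y -> y <= 1 ->
  exists2 c, x <= c <= y & f y - f x = derive_I f c * (y - x).
Proof.
move=> x0 xy y1; have Cf := diff_I_C1 f.
have sub : `[x, y] `<=` I.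
  by move=> z/=; rewrite !in_itv/= => /andP[? ?]; apply/andP; split; lra.
have cf := continuous_subspaceW sub (C1_I_continuous Cf).
have [|c + ->] := @MVT_segment R f (derive_I f) x y xy _ cf.
  move=> z; rewrite in_itv/= => /andP[? ?]; apply: C1_I_is_derive => //.
  by apply/andP; split; lra.
by rewrite in_itv/= => cI; exists c.
Qed.

Lemma C1_C1_I (F : R -> R) (u : R -> R) : C1 F -> (forall x, 0 <= x <= 1 -> u x = F x) ->
  C1_I u /\ forall x, 0 <= x <= 1 -> derive_I u x = F^`()%classic x.
Proof.
move=> CF uF.
have H x : I x -> slope_fun u x @ within I x^' --> F^`()%classic x.
  move=> Ix; have xI : 0 <= x <= 1 by move: Ix; rewrite /= in_itv.
  have sFI := slope_fun_derive1 (CF.1 x).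
  apply: cvg_trans sFI; apply: (@near_eq_cvg _ _ (within I x^')).
  suff : \forall y \near x, y != x -> I y -> slope_fun F x y = slope_fun u x y by [].
  exists 1 => //= y _ _; rewrite in_itv/= => yI.
  by rewrite /slope_fun !uF.
have dE x : 0 <= x <= 1 -> derive_I u x = F^`()%classic x.
  by move=> xI; have Ix : I x by [rewrite /= in_itv]; exact: derive_IE (H x Ix).
split=> //; split=> [x Ix|].
  by apply/cvg_ex; exists (F^`()%classic x); exact: H.
apply: (@subspace_eq_continuous _ I _ F^`()%classic).
  by move=> x /[!inE] /=; rewrite in_itv/= => xI; rewrite /from_subspace dE.
by apply: continuous_subspaceT; case: CF.
Qed.

End IntervalCalculus.

Section IntervalMaximal.
Context {R : realType}.
Implicit Types (f g h : diff_I R) (x y : R).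
Local Notation I := (`[0%R, 1%R]%classic : set R).
Local Notation leb := (@lebesgue_measure R).

Lemma diff_I_of_C1 (F G : R -> R) : F 0 = 0 -> F 1 = 1 ->
  cancel F G -> cancel G F -> {homo F : x y / x < y} -> C1 F -> C1 G ->
  abs_continuous 0 1 F^`()%classic ->
  exists g : diff_I R, forall x, 0 <= x <= 1 -> derive_I g x = F^`()%classic x.
Proof.
move=> F0 F1 FK GK Finc CF CG acF.
have Fmono : {mono F : x y / x <= y} by apply: le_mono.
have Gmono : {mono G : x y / x <= y} by move=> x y; rewrite -Fmono !GK.
have FI x : (0 <= F x <= 1) = (0 <= x <= 1) by rewrite -{1}F0 -{1}F1 !Fmono.
have GI x : (0 <= G x <= 1) = (0 <= x <= 1) by rewrite -FI GK.
(* [F] maps [[0, 1]] onto itself, so replacing it by the identity outside, as [is_diff_I] asks,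
   keeps it invertible. *)
pose u x := if 0 <= x <= 1 then F x else x.
pose v x := if 0 <= x <= 1 then G x else x.
have uF x : 0 <= x <= 1 -> u x = F x by rewrite /u => ->.
have vG x : 0 <= x <= 1 -> v x = G x by rewrite /v => ->.
have [Cu uE] := C1_C1_I CF uF; have [Cv _] := C1_C1_I CG vG.
have du : is_diff_I u.
  split; last 1 first.
  - by apply: eq_abs_continuous acF => x xI; rewrite uE.
  - by move=> x; rewrite /= in_itv/= /u => /negP/negbTE ->.
  - move=> x y; rewrite !inE/= !in_itv/= => xI yI xy.
    by rewrite !uF//; exact: Finc.
  - exact: Cu.
  - exists v; split; last exact: Cv; move=> x;
      have [xI|/negbTE xI] := boolP (0 <= x <= 1).
    + by rewrite uF// vG ?FI// FK.
    + by rewrite /u xI /v xI.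
    + by rewrite vG// uF ?GI// GK.
    + by rewrite /v xI /u xI.
by exists (DiffI du).
Qed.

Lemma abs_continuous_expR_ln (u : R -> R) a b (t : R) : a <= b -> 0 <= t <= 1 ->
  (forall x, a <= x <= b -> 0 < u x) -> abs_continuous a b u ->
  abs_continuous a b (fun x => expR (t * ln (u x))).
Proof.
move=> ab /andP[t0 t1] u0 acu; have acl := abs_continuous_ln ab acu u0.
have [c _ cM] := EVT_max ab (continuous_subspaceT (A := `[a, b]) (abs_continuous_clamp ab acl)).
(* As [t] lies in [[0, 1]], this bounds [t * ln (u x)] from above even when [ln (u x)] is
   negative. *)
pose M := Num.max 0 (ln (u (clamp a b c))).
have lM x : a <= x <= b -> t * ln (u x) <= M.
  move=> xI; have := cM x; rewrite in_itv/= => /(_ xI); rewrite (clamp_id xI) => lc.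
  have lM : ln (u x) <= M by rewrite le_max lc orbT.
  have M0 : 0 <= M by rewrite le_max lexx.
  by nra.
apply: (abs_continuous_dom acl acl (K := expR M * t) (L := 0)) => x y ax xy yb.
rewrite mul0r addr0 -mulrA -(ger0_norm t0) -normrM mulrBr (ger0_norm t0).
by apply: expR_dist; apply: lM; apply/andP; split; lra.
Qed.

(** Integrate the power [(D f)^t], extended to the line by [clamp], and rescale; the rescaling
    factor contributes the constant. *)
Lemma diff_I_chain f (t : R) : 0 <= t <= 1 -> exists g c,
  forall x, 0 <= x <= 1 -> ln (derive_I g x) = t * ln (derive_I f x) + c.
Proof.
move=> tI; pose w0 x := expR (t * ln (derive_I f x)).
have acw : abs_continuous 0 1 w0.
  by apply: abs_continuous_expR_ln => //; [exact: derive_I_gt0|exact: diff_I_ac].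
have w00 x : 0 <= x <= 1 -> 0 < w0 x by rewrite expR_gt0.
have [m m0 wm] := abs_continuous_gt0_lb ler01 acw w00.
have cw := abs_continuous_clamp ler01 acw.
have wm' x : m <= (w0 \o clamp 0 1) x by apply: wm; exact: clamp_itv ler01.
have [F [G [c [c0 F0 F1 [FK GK Finc] [CF CG FE]]]]] := normalized_primitive cw m0 wm'.
have FE' x : 0 <= x <= 1 -> F^`()%classic x = c * w0 x by move=> xI; rewrite FE/= clamp_id.
have [|g gE] := diff_I_of_C1 F0 F1 FK GK Finc CF CG.
  apply: (abs_continuous_dom acw acw (K := c) (L := 0)) => x y x0 xy y1.
  rewrite !FE'; [|by apply/andP; split; lra..].
  by rewrite -mulrBr normrM gtr0_norm// mul0r addr0.
exists g, (ln c) => x xI; rewrite gE// FE'// lnM ?posrE ?expR_gt0// expRK addrC.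
by [].
Qed.

Lemma rho_IE f g : rho_I f g = sup [set `|f x - g x| | x in I] +
  sup [set `|derive_I f x - derive_I g x| | x in I] +
  unit_TV (fun x => derive_I f x - derive_I g x).
Proof.
congr (_ + _); apply: integral_dist_unit_TV; try exact: diff_I_ac;
  by move=> x; exact: derive_I_derive1.
Qed.

Lemma nonlinearity_dist_IE f g : nonlinearity_dist_I f g =
  unit_TV (fun x => ln (derive_I f x) - ln (derive_I g x)).
Proof.
apply: integral_log_dist_unit_TV; try exact: diff_I_ac; try exact: derive_I_gt0;
  by move=> x; exact: derive_I_derive1.
Qed.

(** The summand [ln (derive_I h x)] cancels, leaving the difference for [f] and [g] composed with
    [h]. *)
Lemma nonlinearity_dist_I_comp_le f g h :
  nonlinearity_dist_I (f * h)%g (g * h)%g <= nonlinearity_dist_I f g.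
Proof.
have fhE x : 0 <= x <= 1 -> derive_I (f * h)%g x = derive_I f (h x) * derive_I h x.
  exact: derive_I_chain.
have ghE x : 0 <= x <= 1 -> derive_I (g * h)%g x = derive_I g (h x) * derive_I h x.
  exact: derive_I_chain.
move: (f * h)%g (g * h)%g fhE ghE => fh gh fhE ghE.
rewrite !nonlinearity_dist_IE.
have lac (k : diff_I R) : abs_continuous 0 1 (fun x => ln (derive_I k x)).
  exact: (abs_continuous_ln ler01 (diff_I_ac k) (@derive_I_gt0 R k)).
pose u x := ln (derive_I f x) - ln (derive_I g x).
have uac : abs_continuous 0 1 u by exact: abs_continuousB.
have acfg : abs_continuous 0 1 (fun x => ln (derive_I fh x) - ln (derive_I gh x)).
  exact: abs_continuousB.
have E x : 0 <= x <= 1 -> (u \o h) x = ln (derive_I fh x) - ln (derive_I gh x).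
  move=> xI; have hI := diff_I_itv h xI.
  have f0 := derive_I_gt0 f hI; have g0 := derive_I_gt0 g hI; have h0 := derive_I_gt0 h xI.
  rewrite /u /= (fhE x xI) (ghE x xI).
  move: (derive_I f (h x)) (derive_I g (h x)) (derive_I h x) f0 g0 h0 => p q r p0 q0 r0.
  by rewrite !lnM ?posrE//; ring.
rewrite -(eq_unit_TV acfg E) /unit_TV.
have := @TV_comp_le R 0 1 u h ltr01 (@diff_I_lt R h); rewrite diff_I0 diff_I1 => H.
have fu : total_variation 0 1 u \is a fin_num.
  by apply/(bounded_variationP _ ler01); exact: (abs_continuous_BV ler01 uac).
have uh0 : (0 <= total_variation 0 1 (u \o h))%E by exact: total_variation_ge0 ler01.
have u0 : (0 <= total_variation 0 1 u)%E by exact: total_variation_ge0 ler01.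
have fuh : total_variation 0 1 (u \o h) \is a fin_num.
  by rewrite (ge0_fin_numE uh0); apply: le_lt_trans H _; rewrite -(ge0_fin_numE u0).
exact: (fine_le fuh fu H).
Qed.

Lemma nonlinearity_dist_I_right_invariant : right_invariant (@nonlinearity_dist_I R).
Proof.
move=> f g h; apply: le_anti; apply/andP; split.
  exact: nonlinearity_dist_I_comp_le.
(* The reverse inequality is the same one, applied to the inverse of [h]. *)
have := nonlinearity_dist_I_comp_le (f * h)%g (g * h)%g (h^-1)%g.
by rewrite !mulgK.
Qed.

Lemma nonlinearity_dist_I_maximal : maximal_pseudometric (@nonlinearity_dist_I R).
Proof.
have DI x : 0 <= x <= 1 -> derive_I (1%g : diff_I R) x = 1.
  by move=> xI; apply: derive_I_id; rewrite /= in_itv.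
apply: (@maximal_pseudometric_of_chain R (diff_I R) (fun f => derive_I f)
  (fun f g => sup [set `|f x - g x| | x in I]) (@rho_I R) _ setT).
- by [].
- by move=> f x; exact: derive_I_gt0.
- exact: diff_I_ac.
- move=> f g; apply: le_trans (normr_ge0 (f 0 - g 0)) _; apply: ub_le_sup.
    exists 1 => _ [x /= + <-]; rewrite in_itv/= => xI.
    have /andP[? ?] := diff_I_itv f xI; have /andP[? ?] := diff_I_itv g xI.
    by rewrite ler_norml; apply/andP; split; lra.
  by exists 0 => //=; rewrite in_itv/= lexx ler01.
- exact: rho_IE.
- exact: nonlinearity_dist_IE.
- exact: nonlinearity_dist_I_right_invariant.
- exact: DI.
- by [].
(* Both end points are fixed, so the average slope is 1. *)
- move=> f _; have [c cI] := diff_I_MVT f (lexx 0) ler01 (lexx 1).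
  by rewrite diff_I0 diff_I1 subr0 mulr1 => /esym; exists c.
- move=> h _ h1; apply: diff_I_ext => x /=.
  have [xI|xI] := boolP (0 <= x <= 1); last first.
    by have [+ _ _ _ _] := diff_I_prop h; apply; rewrite /= in_itv/=; exact/negP.
  have /andP[x0 x1] := xI.
  have [c /andP[c0 cx]] := diff_I_MVT h (lexx 0) x0 x1.
  by rewrite diff_I0 !subr0 h1 ?mul1r// c0 (le_trans cx).
- move=> f t _ tI; have [g [c gE]] := diff_I_chain f tI; by exists g, c.
- move=> h e _ he; apply: ge_sup.
    by exists `|(1%g : diff_I R) 0 - h 0|; exists 0 => //=; rewrite in_itv/= lexx ler01.
  move=> _ [x /= + <-]; rewrite in_itv/= => /andP[x0 x1].
  have [c /andP[c0 cx]] := diff_I_MVT h (lexx 0) x0 x1.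
  rewrite diff_I0 !subr0 => ->.
  have cI : 0 <= c <= 1 by rewrite c0 (le_trans cx).
  have -> : x - derive_I h c * x = - ((derive_I h c - 1) * x) by ring.
  rewrite normrN normrM (ger0_norm x0); apply: le_trans (he c cI).
  by rewrite ler_piMr.
- by move=> s _; exists 0 => f; exists f; split=> //; rewrite addr0.
Qed.

End IntervalMaximal.

(** * The circle *)

Section CircleCalculus.
Context {R : realType}.
Implicit Types (f g h : diff_circle R) (x y : R) (F G H : R -> R).
Local Notation pi := (@circle_proj R).

Lemma circle_proj_add x n : n \is a Num.int -> pi (x + n) = pi x.
Proof. by move=> nint; apply/circle_projP; rewrite addrAC subrr add0r. Qed.

Lemma circle_proj_unit (p : circle R) : exists2 x, 0 <= x <= 1 & pi x = p.
Proof.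
have [x <-] := circle_proj_surj p; exists (x - (Num.floor x)%:~R).
  by have /andP[] := floor_itv x; rewrite intrD => *; apply/andP; split; lra.
by rewrite circle_proj_add// rpredN intr_int.
Qed.

Lemma degree_one_int F x n : (forall x, F (x + 1) = F x + 1) -> n \is a Num.int ->
  F (x + n) = F x + n.
Proof.
move=> F1 /intrP[m ->].
have H (k : nat) y : F (y + k%:R) = F y + k%:R.
  by elim: k => [|k IH]; rewrite ?addr0// -[k.+1%:R]natr1 !addrA F1 IH.
case: m => k; first exact: H.
rewrite NegzE mulrNz -pmulrn; have := H k.+1 (x - k.+1%:R); rewrite subrK => ->.
by rewrite addrK.
Qed.

(** Adding the identity turns a periodic function into one of degree one. *)
Lemma periodic_int u x n : (forall x, u (x + 1) = u x) -> n \is a Num.int ->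
  u (x + n) = u x :> R.
Proof.
move=> u1 nint; have := @degree_one_int (fun x => u x + x) x n _ nint.
by rewrite addrA => H; apply: (addIr x); apply: (addIr n); apply: H => y; rewrite u1 addrA.
Qed.

Lemma lift_add_int (f : circle R -> circle R) F n : n \is a Num.int -> is_lift f F ->
  is_lift f (fun x => F x + n).
Proof. by move=> nint fF x; rewrite fF circle_proj_add. Qed.

(** The increment over a period is a constant positive integer, so [F] reaches [F 0 + 1] at some [y]
    in [[0, 1]]. Injectivity of [f] makes [y] an integer, and [y = 0] is impossible. *)
Lemma lift_degree_one f F : is_lift f F -> {homo F : x y / x < y} -> continuous F ->
  forall x, F (x + 1) = F x + 1.
Proof.
move=> fF Finc cF.
have int1 : (1 : R) \is a Num.int by exact: rpred1.
have nint x : F (x + 1) - F x \is a Num.int.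
  by apply/circle_projP; rewrite -!fF circle_proj_add.
have cn : continuous (fun x => F (x + 1) - F x).
  move=> x; apply: cvgB; last exact: cF.
  apply: continuous_comp; last exact: cF.
  by apply: cvgD; [exact: cvg_id|exact: cvg_cst].
have n0 x : F (x + 1) - F x = F 1 - F 0.
  by rewrite (continuous_int_cst cn nint x 0) add0r.
suff F1 : F 1 - F 0 = 1 by move=> x; have := n0 x; rewrite F1; lra.
have := nint 0; rewrite add0r => /intrP[k kE].
have k1 : 1 <= F 1 - F 0.
  have : 0 < F 1 - F 0 by rewrite subr_gt0 Finc.
  by rewrite kE ltr0z gtz0_ge1 -(ler_int R).
have [|y /andP[y0 y1] Fy] := @IVT _ F 0 1 (F 0 + 1) ler01 (continuous_subspaceT cF).
  by rewrite ge_min le_max; apply/andP; split; apply/orP; [left|right]; lra.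
have [g [fK _]] := diff_circle_inverse f.
have : pi y = pi 0 by apply: (can_inj fK); rewrite !fF Fy circle_proj_add.
move/circle_projP; rewrite subr0 => /intrP[m mE].
have m0 : 0 <= m by rewrite -(ler_int R) -mE.
have m1 : m <= 1 by rewrite -(ler_int R) -mE.
have [m00|m10] : m = 0 \/ m = 1.
    by case: m m0 m1 {mE} => [[|[|k']]|k'] // _ _; [left|right].
  by move: Fy; rewrite mE m00; lra.
by move: Fy; rewrite mE m10; lra.
Qed.

Lemma diff_circle_lift f : exists F, [/\ is_lift f F, {homo F : x y / x < y}, C1 F,
  F^`()%classic = derive_circle f & 0 <= F 0 < 1].
Proof.
have [[F [fF Finc CF _]] _] := diff_circle_prop f.
(* Shifting by the integer part puts [F 0] in [[0, 1[], as [TV_periodic] and the splitting of a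
   rotation require. *)
pose n : R := (Num.floor (F 0))%:~R.
have nint : - n \is a Num.int by rewrite rpredN intr_int.
have fFn := lift_add_int nint fF.
have dFn x : is_derive x 1 (fun x => F x + - n) (F^`()%classic x).
  rewrite -[X in is_derive _ _ _ X]addr0; apply: is_deriveD; exact: C1_is_derive.
have [CFn FnE] := is_derive_C1 dFn CF.2.
exists (fun x => F x + - n); split=> //.
- by move=> x y xy; rewrite ltrD2r Finc.
- by apply: derive_circleE => //; exact: C1_continuous.
- by have /andP[] := floor_itv (F 0); rewrite intrD -/n => *; apply/andP; split; lra.
Qed.

Lemma derive_circle_ac f a b : abs_continuous a b (derive_circle f).
Proof.
have [[F [fF _ CF acF]] _] := diff_circle_prop f.
by rewrite -(derive_circleE fF (C1_continuous CF)).
Qed.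

Lemma continuous_derive_circle f : continuous (derive_circle f).
Proof. by have [F [_ _ CF <- _]] := diff_circle_lift f; exact: CF.2. Qed.

Lemma derive_circle_mul f h H x : is_lift h H -> C1 H ->
  derive_circle (f * h)%g x = derive_circle f (H x) * derive_circle h x.
Proof.
move=> hH CH; have [F [fF _ CF FE _]] := diff_circle_lift f.
have CFH := C1_comp CF CH.
rewrite -(derive_circleE (is_lift_comp fF hH : is_lift (f * h)%g _) (C1_continuous CFH)).
rewrite -FE -(derive_circleE hH (C1_continuous CH)) derive1_comp//; [exact: CH.1|exact: CF.1].
Qed.

Lemma derive_circle1 x : derive_circle (1%g : diff_circle R) x = 1.
Proof.
rewrite -(derive_circleE (_ : is_lift (1%g : diff_circle R) id))//.
  by rewrite derive1_id.
by move=> y; exact: cvg_id.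
Qed.

Lemma derive_circle_gt0 f x : 0 < derive_circle f x.
Proof.
have [F [fF Finc CF <- _]] := diff_circle_lift f.
have fE := derive_circleE fF (C1_continuous CF).
have := derive_circle_mul (f^-1)%g x fF CF; rewrite mulVg derive_circle1 -fE => F1.
rewrite lt_neqAle; apply/andP; split.
  by apply/eqP => F0; move: F1; rewrite -F0 mulr0 => /eqP; rewrite oner_eq0.
apply: (@incr_derive1_ge0 R F setT); rewrite ?interiorT//.
  by move=> y _; exact: CF.1.
by move=> y z _ _; exact: Finc.
Qed.

Lemma is_derive_translate F x : C1 F ->
  is_derive x 1 (fun y => F (y + 1)) (F^`()%classic (x + 1)).
Proof.
move=> CF; rewrite -[X in is_derive _ _ _ X]mulr1.
have := @is_derive1_comp R F (fun y => y + 1) x _ 1 (C1_is_derive (x + 1) CF); apply.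
by rewrite -[X in is_derive _ _ _ X]addr0; exact: is_deriveD.
Qed.

Lemma derive1_degree_one F x : C1 F -> (forall x, F (x + 1) = F x + 1) ->
  F^`()%classic (x + 1) = F^`()%classic x.
Proof.
move=> CF F1.
have D1 := is_derive_translate x CF.
have D2 : is_derive x 1 (fun y => F y + 1) (F^`()%classic x + 0).
  by apply: is_deriveD; exact: C1_is_derive.
have FF : (fun y => F (y + 1)) = (fun y => F y + 1) by apply/funext => y; exact: F1.
by rewrite FF in D1; have [_] := D1; have [_ ->] := D2; rewrite addr0.
Qed.

Lemma derive_circle_periodic f x : derive_circle f (x + 1) = derive_circle f x.
Proof.
have [F [fF Finc CF <- _]] := diff_circle_lift f.
exact: derive1_degree_one (lift_degree_one fF Finc (C1_continuous CF)).
Qed.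

(** Degree one makes the class of the value independent of the chosen representative. *)
Lemma map_of_lift F : (forall x, F (x + 1) = F x + 1) ->
  exists phi : circle R -> circle R, is_lift phi F.
Proof.
move=> F1; have /choice[r rK] := @circle_proj_surj R.
exists (fun p => pi (F (r p))) => x.
have /circle_projP rx := rK (pi x).
by rewrite -[r _](subrK x) addrC (degree_one_int _ F1 rx) circle_proj_add.
Qed.

Lemma lift_cancel (phi psi : circle R -> circle R) F G : is_lift phi F -> is_lift psi G ->
  cancel F G -> cancel phi psi.
Proof.
move=> pF pG FK p; have [x <-] := circle_proj_surj p.
by rewrite pF pG FK.
Qed.

Lemma diff_circle_of_lift F G : (forall x, F (x + 1) = F x + 1) ->
  cancel F G -> cancel G F -> {homo F : x y / x < y} -> C1 F -> C1 G ->
  (forall a b, abs_continuous a b F^`()%classic) ->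
  exists g : diff_circle R, is_lift g F /\ derive_circle g = F^`()%classic.
Proof.
move=> F1 FK GK Finc CF CG acF.
have G1 x : G (x + 1) = G x + 1 by rewrite -{1}[x]GK -F1 FK.
have [phi phiF] := map_of_lift F1; have [psi psiG] := map_of_lift G1.
have dphi : is_diff_circle phi.
  split; first by exists F.
  exists psi; split; [exact: lift_cancel phiF psiG FK|exact: lift_cancel psiG phiF GK|].
  by exists G.
exists (DiffCircle dphi); split=> //.
by rewrite (derive_circleE (_ : is_lift (DiffCircle dphi) F))//; exact: C1_continuous.
Qed.

Lemma circle_dist_le x y : circle_dist (pi x) (pi y) <= `|x - y|.
Proof.
apply: ge_inf; last by exists x => //; exists y.
by exists 0 => _ [? _ [? _ <-]].
Qed.

Lemma circle_dist_ge0 (p q : circle R) : 0 <= circle_dist p q.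
Proof.
apply: lb_le_inf; last by move=> _ [? _ [? _ <-]].
have [x <-] := circle_proj_surj p; have [y <-] := circle_proj_surj q.
by exists `|x - y|; exists x => //; exists y.
Qed.

End CircleCalculus.

Section CircleMaximal.
Context {R : realType}.
Implicit Types (f g h : diff_circle R) (x y : R) (F G H : R -> R).
Local Notation I := (`[0%R, 1%R]%classic : set R).
Local Notation leb := (@lebesgue_measure R).
Local Notation pi := (@circle_proj R).

Lemma derive_circle_chain f (t : R) : 0 <= t <= 1 -> exists g c,
  g (pi 0) = pi 0 /\ forall x, ln (derive_circle g x) = t * ln (derive_circle f x) + c.
Proof.
move=> tI; pose w x := expR (t * ln (derive_circle f x)).
have Df0 a b x : a <= x <= b -> 0 < derive_circle f x by move=> _; exact: derive_circle_gt0.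
have acw a b : a <= b -> abs_continuous a b w.
  by move=> ab; apply: abs_continuous_expR_ln => //; [exact: Df0|exact: derive_circle_ac].
have cw : continuous w.
  move=> x; apply: continuous_comp; last exact: continuous_expR.
  apply: cvgM; first exact: cvg_cst.
  apply: continuous_comp; first exact: continuous_derive_circle.
  exact/continuous_ln/derive_circle_gt0.
have w1 x : w (x + 1) = w x by rewrite /w derive_circle_periodic.
have w0 x : 0 <= x <= 1 -> 0 < w x by rewrite expR_gt0.
have [m m0 wm] := abs_continuous_gt0_lb ler01 (acw 0 1 ler01) w0.
have wm' x : m <= w x.
  have nint : - (Num.floor x)%:~R \is a @Num.int R by rewrite rpredN intr_int.
  rewrite -(periodic_int x w1 nint); apply: wm.
  by have /andP[] := floor_itv x; rewrite intrD => *; apply/andP; split; lra.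
have [F [G [c [c0 F0 F1 [FK GK Finc] [CF CG FE]]]]] := normalized_primitive cw m0 wm'.
(* Periodicity of [w] makes [F (x + 1) - F x] constant; the normalization [F 1 = 1] gives its
   value. *)
have Fdeg x : F (x + 1) = F x + 1.
  have D y : is_derive y 1 (fun z => F (z + 1) - F z) 0.
    have -> : 0 = F^`()%classic (y + 1) - F^`()%classic y by rewrite FE w1 subrr.
    by apply: is_deriveB; [exact: is_derive_translate|exact: C1_is_derive].
  by have := is_derive_0_is_cst x 0 D; rewrite add0r F0 F1; lra.
have acF a b : abs_continuous a b F^`()%classic.
  have [ab|ba] := leP a b.
    apply: (abs_continuous_dom (acw a b ab) (acw a b ab) (K := c) (L := 0)) => x y _ _ _.
    by rewrite FE -mulrBr normrM gtr0_norm// mul0r addr0.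
  apply: eq_abs_continuous (abs_continuous_cst a b 0) => x /andP[ax xb].
  by exfalso; lra.
have [g [gF gE]] := diff_circle_of_lift Fdeg FK GK Finc CF CG acF.
exists g, (ln c); split; first by rewrite gF F0.
by move=> x; rewrite gE FE lnM ?posrE ?expR_gt0// expRK addrC.
Qed.

Lemma rho_circleE f g : rho_circle f g = sup (range (fun p => circle_dist (f p) (g p))) +
  sup [set `|derive_circle f x - derive_circle g x| | x in I] +
  unit_TV (fun x => derive_circle f x - derive_circle g x).
Proof. by congr (_ + _); apply: integral_dist_unit_TV => //; exact: derive_circle_ac. Qed.

Lemma nonlinearity_dist_circleE f g : nonlinearity_dist_circle f g =
  unit_TV (fun x => ln (derive_circle f x) - ln (derive_circle g x)).
Proof.
by apply: integral_log_dist_unit_TV => // [||x _|x _]; try exact: derive_circle_ac;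
  exact: derive_circle_gt0.
Qed.

Lemma ln_derive_circle_ac f : abs_continuous 0 1 (fun x => ln (derive_circle f x)).
Proof.
apply: (abs_continuous_ln ler01 (derive_circle_ac f 0 1)) => x _.
exact: derive_circle_gt0.
Qed.

(** As on the interval, except that the lift [H] carries [[0, 1]] to another period, over which the
    periodic [u] has the same variation. *)
Lemma nonlinearity_dist_circle_comp_le f g h :
  nonlinearity_dist_circle (f * h)%g (g * h)%g <= nonlinearity_dist_circle f g.
Proof.
have [H [hH Hinc CH HE H01]] := diff_circle_lift h.
have fhE x : derive_circle (f * h)%g x = derive_circle f (H x) * derive_circle h x.
  exact: derive_circle_mul.
have ghE x : derive_circle (g * h)%g x = derive_circle g (H x) * derive_circle h x.
  exact: derive_circle_mul.
move: (f * h)%g (g * h)%g fhE ghE => fh gh fhE ghE.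
rewrite !nonlinearity_dist_circleE.
pose u x := ln (derive_circle f x) - ln (derive_circle g x).
have uac : abs_continuous 0 1 u.
  exact: abs_continuousB (ln_derive_circle_ac f) (ln_derive_circle_ac g).
have acfg := abs_continuousB (ln_derive_circle_ac fh) (ln_derive_circle_ac gh).
have E x : 0 <= x <= 1 -> (u \o H) x = ln (derive_circle fh x) - ln (derive_circle gh x).
  move=> _; have f0 := derive_circle_gt0 f (H x); have g0 := derive_circle_gt0 g (H x).
  have h0 := derive_circle_gt0 h x; rewrite /u /= fhE ghE.
  move: (derive_circle f (H x)) (derive_circle g (H x)) (derive_circle h x) f0 g0 h0 => p q r p0 q0 r0.
  by rewrite !lnM ?posrE//; ring.
rewrite -(eq_unit_TV acfg E) /unit_TV.
have u1 x : u (x + 1) = u x by rewrite /u !derive_circle_periodic.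
have := @TV_comp_le R 0 1 u H ltr01 (fun x y _ xy _ => Hinc x y xy).
have -> : H 1 = H 0 + 1.
  by rewrite -(lift_degree_one hH Hinc (C1_continuous CH)) add0r.
rewrite (TV_periodic u1 H01) => uH.
have fu : total_variation 0 1 u \is a fin_num.
  by apply/(bounded_variationP _ ler01); exact: (abs_continuous_BV ler01 uac).
have uh0 : (0 <= total_variation 0 1 (u \o H))%E by exact: total_variation_ge0 ler01.
have u0 : (0 <= total_variation 0 1 u)%E by exact: total_variation_ge0 ler01.
have fuh : total_variation 0 1 (u \o H) \is a fin_num.
  by rewrite (ge0_fin_numE uh0); apply: le_lt_trans uH _; rewrite -(ge0_fin_numE u0).
exact: (fine_le fuh fu uH).
Qed.

Lemma nonlinearity_dist_circle_right_invariant :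
  right_invariant (@nonlinearity_dist_circle R).
Proof.
move=> f g h; apply: le_anti; apply/andP; split.
  exact: nonlinearity_dist_circle_comp_le.
have := nonlinearity_dist_circle_comp_le (f * h)%g (g * h)%g (h^-1)%g.
by rewrite !mulgK.
Qed.

Lemma circle_rotation (a : R) :
  exists2 r : diff_circle R, is_lift r (fun x => x + a) & forall x, derive_circle r x = 1.
Proof.
have D (b x : R) : is_derive x 1 (fun y => y + b) 1.
  by rewrite -[X in is_derive _ _ _ X]addr0; exact: is_deriveD.
have C (b : R) : C1 (fun y => y + b) /\ (fun y => y + b)^`()%classic = fun=> 1.
  by apply: is_derive_C1 => // x; exact: cvg_cst.
have [C1a aE] := C a; have [C1a' _] := C (- a).
have [|||||r [rF rE]] := @diff_circle_of_lift R (fun x => x + a) (fun x => x + - a) _ _ _ _ C1a C1a'.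
- by move=> x; rewrite addrAC.
- by move=> x /=; rewrite addrK.
- by move=> x /=; rewrite subrK.
- by move=> x y xy; rewrite ltrD2r.
- by move=> b c; rewrite aE; exact: abs_continuous_cst.
by exists r => // x; rewrite rE aE.
Qed.

Lemma sup_circle_dist_ge0 f g : 0 <= sup (range (fun p => circle_dist (f p) (g p))).
Proof.
(* [sup] is 0 on sets without a supremum. *)
have [hs|/sup_out->//] := pselect (has_sup (range (fun p => circle_dist (f p) (g p)))).
apply: le_trans (circle_dist_ge0 (f (pi 0)) (g (pi 0))) _.
by apply: ub_le_sup; [case: hs|exists (pi 0)].
Qed.

(* A rotation is a product of boundedly many rotations by a fixed small angle. *)
Lemma circle_rotation_bounded (s : diff_circle R -> diff_circle R -> R) :
  continuous_right_invariant_pseudometric s ->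
  exists N : R, forall (r : diff_circle R) (a : R), 0 <= a <= 1 -> is_lift r (fun x => x + a) -> s r 1%g <= N.
Proof.
move=> cs; have [[s0 sxx sC stri] _ sright] := cs.
have [e e0 se] := pseudometric_unit_ball (rho := @rho_circle R) (fun U oU => oU) cs.
have /choice[r rP] : forall a : R, exists r : diff_circle R,
    is_lift r (fun x => x + a) /\ forall x, derive_circle r x = 1.
  by move=> a; have [r] := circle_rotation a; exists r.
have rU g a : is_lift g (fun x => x + a) -> g = r a.
  move=> ga; apply: diff_circle_ext => p; have [x <-] := circle_proj_surj p.
  by rewrite ga (rP a).1.
(* Rotations have derivative 1, so only the uniform distance, at most [a], contributes to
   [rho_circle]. *)
have small a : 0 <= a -> a < e -> s (r a) 1%g < 1.
  move=> a0 ae; apply: se; rewrite rho_circleE.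
  have -> : unit_TV (fun x => derive_circle 1%g x - derive_circle (r a) x) = 0.
    apply/eqP; rewrite eq_le unit_TV_ge0 andbT.
    rewrite -[leRHS](mul0r (unit_TV (fun=> 0 : R))).
    apply: (unit_TV_scale (c := 0)) => //; first exact: abs_continuous_cst.
    by move=> x _; rewrite derive_circle1 (rP a).2; ring.
  have -> : sup [set `|derive_circle 1%g x - derive_circle (r a) x| | x in I] = 0.
    have -> : [set `|derive_circle 1%g x - derive_circle (r a) x| | x in I] = [set 0].
      apply/seteqP; split=> [_ [x _ <-]|_ ->] /=.
        by rewrite derive_circle1 (rP a).2 subrr normr0.
      exists 0; first by rewrite /= in_itv/= lexx ler01.
      by rewrite derive_circle1 (rP a).2 subrr normr0.
    by rewrite sup1.
  rewrite !addr0; apply: le_lt_trans ae; apply: ge_sup.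
    by exists (circle_dist ((1%g : diff_circle R) (pi 0)) (r a (pi 0))); exists (pi 0).
  move=> _ [p _ <-]; have [x <-] := circle_proj_surj p; rewrite (rP a).1.
  apply: le_trans (circle_dist_le x (x + a)) _.
  by rewrite opprD addrA subrr sub0r normrN ger0_norm.
(* With [1 / N < e], any angle up to 1 splits into [N] equal angles below [e]. *)
pose N := (Num.truncn e^-1).+1.
have eN : N%:R^-1 < e.
  have ie0 : 0 < e^-1 by rewrite invr_gt0.
  have /andP[_ eN] := truncn_itv (ltW ie0).
  by rewrite -[e]invrK ltf_pV2// posrE ltr0n.
exists N%:R => g a /andP[a0 a1] /rU ->.
have N0 : 0 < N%:R :> R by rewrite ltr0n.
pose b := a / N%:R.
have b0 : 0 <= b by rewrite divr_ge0// ltW.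
have be : b < e.
  by apply: le_lt_trans eN; rewrite /b ler_piMl// invr_ge0 ltW.
have H (k : nat) : s (r (k%:R * b)) 1%g <= k%:R.
  elim: k => [|k IH].
    rewrite mul0r -(rU 1%g 0) ?sxx// => x; rewrite addr0.
    by [].
  have <- : (r b * r (k%:R * b)%R)%g = r (k.+1%:R * b).
    apply: rU => x; rewrite -[k.+1%:R]natr1 mulrDl mul1r addrA.
    by rewrite -(rP b).1 -(rP (k%:R * b)).1.
  have := stri (r b * r (k%:R * b)%R)%g (r (k%:R * b)) 1%g.
  have := sright (r b) 1%g (r (k%:R * b)); rewrite mul1g => ->.
  by have := small b b0 be; rewrite -[k.+1%:R]natr1; lra.
have -> : a = N%:R * b by rewrite /b mulrC divfK// gt_eqF.
exact: H.
Qed.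

Lemma nonlinearity_dist_circle_maximal : maximal_pseudometric (@nonlinearity_dist_circle R).
Proof.
apply: (@maximal_pseudometric_of_chain R (diff_circle R) (@derive_circle R)
  (fun f g => sup (range (fun p => circle_dist (f p) (g p)))) (@rho_circle R) _
  [set f | f (pi 0) = pi 0]).
- by [].
- by move=> f x _; exact: derive_circle_gt0.
- by move=> f; exact: derive_circle_ac.
- exact: sup_circle_dist_ge0.
- exact: rho_circleE.
- exact: nonlinearity_dist_circleE.
- exact: nonlinearity_dist_circle_right_invariant.
- by move=> x _; exact: derive_circle1.
- move=> f g /= f0 g0.
  have gV : (g^-1)%g (g (pi 0)) = pi 0.
    have -> : (g^-1)%g (g (pi 0)) = (g^-1 * g)%g (pi 0) by [].
    by rewrite mulVg.
  rewrite g0 in gV.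
  exact: etrans (congr1 f gV) f0.
(* A lift of degree one has average slope 1 over a period. *)
- move=> f /= _; have [F [fF Finc CF FE _]] := diff_circle_lift f.
  have [c cI] := C1_MVT CF ler01; have := lift_degree_one fF Finc (C1_continuous CF) 0.
  by rewrite add0r FE => -> H; exists c => //; lra.
- move=> h /= h0 h1; have [F [hF Finc CF FE _]] := diff_circle_lift h.
  apply: diff_circle_ext => p; have [x /andP[x0 x1] <-] := circle_proj_unit p.
  have [c /andP[c0 cx]] := C1_MVT CF x0.
  rewrite FE h1 ?mul1r ?subr0; last by rewrite c0 (le_trans cx).
  move=> Fx; rewrite hF; apply/circle_projP.
  have -> : F x - x = F 0 - 0 by lra.
  by apply/circle_projP; rewrite -hF.
- move=> f t _ tI; have [g [c [g0 gE]]] := derive_circle_chain f tI.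
  by exists g, c; split.
- move=> h e /= h0 he; have [F [hF Finc CF FE _]] := diff_circle_lift h.
  apply: ge_sup; first by exists (circle_dist ((1%g : diff_circle R) (pi 0)) (h (pi 0))); exists (pi 0).
  move=> _ [p _ <-]; have [x /andP[x0 x1] <-] := circle_proj_unit p.
  have [c /andP[c0 cx]] := C1_MVT CF x0; rewrite FE subr0 => Fx.
  (* [h] fixes the class of 0, so [F 0] is an integer, and subtracting it gives a lift that fixes
     0. *)
  have F0int : - F 0 \is a Num.int.
    by rewrite rpredN -[F 0]subr0; apply/circle_projP; rewrite -hF.
  rewrite hF -(circle_proj_add (F x) F0int).
  apply: le_trans (circle_dist_le x (F x + - F 0)) _.
  rewrite Fx; have -> : x - derive_circle h c * x = - ((derive_circle h c - 1) * x) by ring.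
  have cI : 0 <= c <= 1 by rewrite c0 (le_trans cx).
  rewrite normrN normrM (ger0_norm x0); apply: le_trans (he c cI).
  by rewrite ler_piMr.
- move=> s cs; have [N sN] := circle_rotation_bounded cs; exists N => f.
  have [[s0 sxx sC stri] _ sright] := cs.
  have [F [fF Finc CF FE /andP[F0 F1]]] := diff_circle_lift f.
  have [r rF r1] := circle_rotation (F 0); have [r' rF' r1'] := circle_rotation (- F 0).
  have rr' : (r * r')%g = 1%g.
    apply: diff_circle_ext => p; have [x <-] := circle_proj_surj p.
    have -> : (r * r')%g (pi x) = r (r' (pi x)) by [].
    by rewrite rF' rF subrK.
  (* Rotating after [f] keeps the derivative, hence [d]; by right invariance it changes the
     [s]-distance to 1 by at most [s r 1]. *)
  exists (r' * f)%g; split.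
  + have H : r' (f (pi 0)) = pi 0 by rewrite fF rF' subrr.
    exact: H.
  + have E x : derive_circle (r' * f)%g x = derive_circle f x.
      by rewrite (derive_circle_mul r' x fF CF) r1' mul1r.
    rewrite !nonlinearity_dist_circleE; congr unit_TV; apply/funext => x.
    by rewrite E.
  + have fE : f = (r * (r' * f))%g by rewrite mulgA rr' mul1g.
    have := stri (r * (r' * f))%g (r' * f)%g 1%g.
    have := sright r 1%g (r' * f)%g; rewrite mul1g -fE => ->.
    have := sN r (F 0); rewrite F0 (ltW F1) => /(_ isT rF); lra.
Qed.

End CircleMaximal.

Theorem theorem4p3 (R : realType) :
  maximal_pseudometric (@nonlinearity_dist_I R) /\
  maximal_pseudometric (@nonlinearity_dist_circle R).
Proof.
split; [exact: nonlinearity_dist_I_maximal|exact: nonlinearity_dist_circle_maximal].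
Qed.
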